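(* Let $X,Y$ be discrete random variables with finite entropy. (i) For any $R'\in[0,I(X;Y)]$, $$C(X,Y;R')=\min I(X,Y;U),$$ where the minimization is over all $U$ jointly distributed with $(X,Y)$ such that $I(X;Y|U)=R'$. (ii) For any $R''\in[0,H(X,Y)-I(X;Y)]$, $$K(X,Y;R'')=\max I(X,Y;W),$$ where the maximization is over all $W$ jointly distributed with $(X,Y)$ such that $I(X;W|Y)+I(Y;W|X)=R''$.
   Context: The lossless Gray-Wyner region $\mathcal R_{GW}$ of $(X,Y)$ is the convex closure of the set of all rate tuples $(R_0,R_1,R_2)$ for which there is a random variable $U$ jointly distributed with $(X,Y)$ with $R_0\ge I(X,Y;U)$, $R_1\ge H(X|U)$, $R_2\ge H(Y|U)$. (By Gray and Wyner it is the set of achievable rates for the network in which an encoder observing $(X^n,Y^n)$ sends an index of rate $R_0$ to two decoders and indices of rates $R_1,R_2$ to the first and second decoder only, which losslessly reconstruct $X^n$ and $Y^n$ respectively.) For $R'\in[0,I(X;Y)]$: $C(X,Y;R')=\inf\{R_0:(R_0,R_1,R_2)\in\mathcal R_{GW},\ R_0+R_1+R_2=H(X,Y)+R'\}$. For $R''\in[0,H(X,Y)-I(X;Y)]$: $K(X,Y;R'')=\sup\{R_0:(R_0,R_1,R_2)\in\mathcal R_{GW},\ 2R_0+R_1+R_2=H(X)+H(Y)+R''\}$. *)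

(* Defs.v *)
From HB Require Import structures.
From mathcomp Require Import all_boot all_order all_algebra.
From mathcomp Require Import all_classical all_reals all_analysis.

Set Implicit Arguments.
Unset Strict Implicit.
Unset Printing Implicit Defensive.

Import Order.TTheory GRing.Theory Num.Theory.
Import numFieldNormedType.Exports.

Local Open Scope classical_set_scope.
Local Open Scope ring_scope.
Local Open Scope ereal_scope.
Local Open Scope charge_scope.

(* Alphabet of a discrete random variable: a countable set whose sigma-algebra
   is the discrete one. *)
HB.mixin Record isDiscreteMeasurable d T & Measurable d T := {
  discrete_countable : countable [set: T];
  discrete_measurable1 : forall x : T, measurable [set x]
}.

#[short(type="discreteMeasurableType")]
HB.structure Definition DiscreteMeasurable d :=
  {T of Measurable d T & isDiscreteMeasurable d T}.

Section discrete_prod.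
Context d1 d2 (A : discreteMeasurableType d1) (B : discreteMeasurableType d2).

Let prod_countable : countable [set: (A * B)%type].
Proof.
by rewrite -setXTT; apply: countableX; exact: discrete_countable.
Qed.

Let prod_measurable1 (x : A * B) : measurable [set x].
Proof.
case: x => a b.
have -> : [set (a, b)] = [set a] `*` [set b].
  by apply/seteqP; split=> [[x y] [-> ->]|[x y] [/= -> ->]].
by apply: measurableX; exact: discrete_measurable1.
Qed.

HB.instance Definition _ := isDiscreteMeasurable.Build _ (A * B)%type
  prod_countable prod_measurable1.

End discrete_prod.

Section discrete_nat.

Let nat_measurable1 (n : nat) : measurable [set n].
Proof. by []. Qed.

HB.instance Definition _ := isDiscreteMeasurable.Build _ nat
  (countableP [set: nat]) nat_measurable1.

End discrete_nat.

Section pair_rv.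
Context d d1 d2 (W : measurableType d) (S : measurableType d1)
  (T : measurableType d2) (R : realType) (P : probability W R).
Variables (X : {RV P >-> S}) (Y : {RV P >-> T}).

Definition pair_rv (w : W) : S * T := (X w, Y w).

Let measurable_pair_rv : measurable_fun [set: W] pair_rv.
Proof. by apply/measurable_fun_pair; exact: measurable_funPT. Qed.

HB.instance Definition _ :=
  isMeasurableFun.Build _ _ _ _ pair_rv measurable_pair_rv.

Definition pairRV : {RV P >-> (S * T)%type} := pair_rv.

End pair_rv.

Section information.
Context d (W : measurableType d) (R : realType) (P : probability W R).

(* Information is measured in nats; 0 * ln 0 = 0 because ln 0 = 0 here. *)
Definition ent_term (p : R) : R := (- (p * ln p))%R.

Definition entropy dE (E : discreteMeasurableType dE) (Z : {RV P >-> E})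
    : \bar R :=
  \esum_(z in [set: E]) (ent_term (fine (distribution P Z [set z])))%:E.

Section conditional.
Context dE dT (E : discreteMeasurableType dE) (T : measurableType dT).
Variables (Z : {RV P >-> E}) (U : {RV P >-> T}).

Definition joint_at (z : E) : set T -> \bar R :=
  fun B => P (Z @^-1` [set z] `&` U @^-1` B).

Section joint_at_measure.
Variable z : E.

Let mZ : measurable (Z @^-1` [set z]).
Proof.
by rewrite -[X in measurable X]setTI; apply: measurable_funPT => //;
  exact: discrete_measurable1.
Qed.

Let mU B : measurable B -> measurable (U @^-1` B).
Proof.
by move=> mB; rewrite -[X in measurable X]setTI; exact: measurable_funPT.
Qed.

Let joint_at0 : joint_at z set0 = 0.
Proof. by rewrite /joint_at preimage_set0 setI0 measure0. Qed.

Let joint_at_ge0 B : 0 <= joint_at z B.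
Proof. exact: measure_ge0. Qed.

Let joint_at_sigma_additive : semi_sigma_additive (joint_at z).
Proof.
move=> F mF tF mUF; rewrite /joint_at preimage_bigcup setI_bigcupr.
apply: measure_semi_sigma_additive.
- by move=> n; apply: measurableI => //; exact: mU.
- apply/trivIsetP => /= i j _ _ ij.
  rewrite setIACA setIid -preimage_setI.
  by move/trivIsetP : tF => /(_ _ _ _ _ ij) ->//; rewrite preimage_set0 setI0.
- rewrite -setI_bigcupr -preimage_bigcup.
  by apply: measurableI => //; exact: mU.
Qed.

HB.instance Definition _ := isMeasure.Build _ _ _ (joint_at z)
  joint_at0 joint_at_ge0 joint_at_sigma_additive.

Let joint_at_fin : fin_num_fun (joint_at z).
Proof.
move=> B mB; apply: fin_num_measure.
by apply: measurableI => //; exact: mU.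
Qed.

HB.instance Definition _ := Measure_isFinite.Build _ _ _ (joint_at z)
  joint_at_fin.

End joint_at_measure.

(* P(Z = z | U = t), the Radon-Nikodym derivative of the measure
   B |-> P(Z = z, U \in B) with respect to the law of U; as usual it is
   determined for almost all t only. *)
Definition cond_pmf (z : E) (t : T) : R :=
  fine (('d (charge_of_finite_measure (joint_at z)) '/d (distribution P U)) t).

(* H(Z | U) = E[ H(Z | U = t) ], for an arbitrary (not necessarily discrete)
   random variable U. *)
Definition cond_entropy : \bar R :=
  \int[distribution P U]_t \esum_(z in [set: E]) (ent_term (cond_pmf z t))%:E.

(* I(Z ; U) and, below, I(Z ; U | V) are meaningful when H(Z) is finite. *)
Definition mutual_info : \bar R := entropy Z - cond_entropy.

End conditional.

Definition cond_mutual_info dE dT dV (E : discreteMeasurableType dE)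
    (T : measurableType dT) (V : measurableType dV)
    (Z : {RV P >-> E}) (U : {RV P >-> T}) (S : {RV P >-> V}) : \bar R :=
  cond_entropy Z S - cond_entropy Z (pairRV U S).

End information.

Section gray_wyner.
Context d (W : measurableType d) (R : realType) (P : probability W R).
Context dA dB (A : discreteMeasurableType dA) (B : discreteMeasurableType dB).
Variables (X : {RV P >-> A}) (Y : {RV P >-> B}).

(* A random variable U, with values in an arbitrary measurable space, jointly
   distributed with (X, Y). Since the probability space carrying X and Y may be
   too small to carry U, one allows another space with a copy (X', Y') of
   (X, Y). *)
Record joint_rv := JointRV {
  jd : measure_display;
  jspace : measurableType jd;
  jP : probability jspace R;
  jX : {RV jP >-> A};
  jY : {RV jP >-> B};
  jdU : measure_display;
  jalphabet : measurableType jdU;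
  jU : {RV jP >-> jalphabet};
  jlaw : forall S : set (A * B), measurable S ->
    distribution jP (pairRV jX jY) S = distribution P (pairRV X Y) S
}.

(* I(X, Y ; U) *)
Definition info_XY (U : joint_rv) : \bar R :=
  mutual_info (pairRV (jX U) (jY U)) (jU U).

(* I(X ; Y | U) *)
Definition info_X_Y_given (U : joint_rv) : \bar R :=
  cond_mutual_info (jX U) (jY U) (jU U).

(* I(X ; U | Y) *)
Definition info_X_given_Y (U : joint_rv) : \bar R :=
  cond_mutual_info (jX U) (jU U) (jY U).

(* I(Y ; U | X) *)
Definition info_Y_given_X (U : joint_rv) : \bar R :=
  cond_mutual_info (jY U) (jU U) (jX U).

(* A rate tuple (R0, R1, R2) is (r.1.1, r.1.2, r.2). *)
Definition gray_wyner_tuples : set (R^o * R^o * R^o) :=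
  [set r | exists U : joint_rv,
    [/\ info_XY U <= (r.1.1)%:E,
        cond_entropy (jX U) (jU U) <= (r.1.2)%:E &
        cond_entropy (jY U) (jU U) <= (r.2)%:E]].

Definition gray_wyner_region : set (R^o * R^o * R^o) :=
  smallest [set C : set (R^o * R^o * R^o) |
      closed C /\ convex_set (M := (R^o * R^o * R^o)%type) C]
    gray_wyner_tuples.

(* C(X, Y ; R') *)
Definition relaxed_wyner_ci (R' : R) : \bar R :=
  ereal_inf [set (r.1.1)%:E | r in [set r : R^o * R^o * R^o |
    gray_wyner_region r /\
    (r.1.1 + r.1.2 + r.2)%:E = entropy (pairRV X Y) + R'%:E]].

(* K(X, Y ; R'') *)
Definition relaxed_gacs_korner_ci (R'' : R) : \bar R :=
  ereal_sup [set (r.1.1)%:E | r in [set r : R^o * R^o * R^o |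
    gray_wyner_region r /\
    (2 * r.1.1 + r.1.2 + r.2)%:E = entropy X + entropy Y + R''%:E]].

End gray_wyner.

(* Main.v *)
(* A joint variable U enters only through the triple (H(X|U), H(Y|U), H(X,Y|U)):
   by the chain rule I(X,Y;U), I(X;Y|U) and I(X;U|Y) + I(Y;U|X) are affine in it.
   The main point is that the set of these triples is closed and convex, so that
   the region is already the set of rate tuples. Given a family U_i and a positive
   normalized linear functional L on bounded families (a convex combination, or a
   limit along an ultrafilter), a single U is built whose triple is the L-mean of
   the triples of the U_i. Replace U_i by the binary digits of its conditional
   probabilities P(E_l | U_i), where E_l runs over the singletons, rows and columns
   of the alphabet; the L-means of the joint laws of (X, Y) and of these bits on
   cylinders form a consistent family, realized on [0, 1) by nested intervals. In
   the limit, the conditional probabilities are still the continuous functions of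
   the bits given by binary expansion, so every E[h(P(E_l | U))],
   h(p) = - p ln p, passes through L, and Jensen's inequality E[h(P(E|U))] <= h(P(E))
   dominates the sums over l.
   The optimum is then attained along an ultralimit of near-optimal U_n, once the
   constraint has been turned into an equality by mixing U with a constant (part i)
   or with (X, Y) (part ii). *)

Require Import Defs.
From HB Require Import structures.
From mathcomp Require Import all_boot all_order all_algebra.
From mathcomp Require Import all_classical all_reals all_analysis.
From mathcomp Require Import measurable_realfun.
From mathcomp Require Import ring lra.

Set Implicit Arguments.
Unset Strict Implicit.
Unset Printing Implicit Defensive.

Import Order.TTheory GRing.Theory Num.Theory.
Import numFieldNormedType.Exports.

Local Open Scope classical_set_scope.
Local Open Scope ring_scope.
Local Open Scope ereal_scope.

(** * The entropy function *)

(** Conditional entropy is not continuous under weak limits of the joint law of (X, Y, U), because a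
    conditional probability is in general not a continuous function of the value of U. Keeping the
    digits of P(E | U) in place of U makes it a fixed continuous function, [value], of the new
    variable; the identity that makes it a conditional probability only involves cylinders and
    continuous functions of the bits, so it survives any mean. Rows and columns get digits of their
    own because P(X = x | U) may be an infinite sum of probabilities of points, and such a sum need
    not be continuous in the bits. A mean is only finitely additive: finite sums and uniform limits
    pass through it, countable sums only under a summable bound independent of the index. The common
    law of (X, Y) provides this bound, and it also prevents mass from escaping to infinity in the
    alphabet. Mixtures use the same construction because the two variables may live on unrelated
    probability spaces, with different copies of (X, Y). *)

Section ent_term_theory.
Context (R : realType).
Local Open Scope ring_scope.
Implicit Types p q t x y g r : R.

Lemma ent_term0 : @ent_term R 0 = 0.
Proof. by rewrite /ent_term mul0r oppr0. Qed.

Lemma ent_term1 : @ent_term R 1 = 0.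
Proof. by rewrite /ent_term ln1 mulr0 oppr0. Qed.

Lemma ent_term_ge0 p : 0 <= p <= 1 -> 0 <= ent_term p.
Proof.
move=> /andP[p0 p1]; rewrite /ent_term oppr_ge0 mulr_ge0_le0//.
exact: ln_le0.
Qed.

(** Concavity: [- ln p * t + p - t] is the tangent at [p], obtained from [ln (1 + x) <= x]. The term
    [t] stands on the left so that both sides are nonnegative for [p] and [t] in [0, 1] and can be
    integrated as extended reals. *)
Lemma ent_term_tangent p t : 0 < p -> 0 <= t ->
  ent_term t + t <= - ln p * t + p.
Proof.
move=> p0; rewrite le_eqVlt => /predU1P[<-|t0].
  by rewrite ent_term0 mulr0 !add0r ltW.
have : ln (1 + (p / t - 1)) <= p / t - 1.
  by apply: le_ln1Dx; rewrite ltrBrDr addNr divr_gt0.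
rewrite addrC subrK ln_div ?posrE// => /(ler_wpM2l (ltW t0)).
rewrite mulrBr mulrBr mulrCA divff ?gt_eqF// /ent_term; lra.
Qed.

Lemma ent_term_le1 p : 0 <= p <= 1 -> ent_term p <= 1.
Proof.
move=> /andP[p0 p1]; have := ent_term_tangent ltr01 p0.
by rewrite ln1; lra.
Qed.

Lemma ent_termM g r : 0 <= g -> 0 <= r ->
  ent_term (g * r) = r * ent_term g + g * ent_term r.
Proof.
rewrite le_eqVlt => /predU1P[<-|g0]; first by rewrite !mul0r ent_term0; lra.
rewrite le_eqVlt => /predU1P[<-|r0]; first by rewrite !(mul0r,mulr0) ent_term0; lra.
by rewrite /ent_term lnM ?posrE//; lra.
Qed.

Lemma measurable_ent_term : measurable_fun [set: R] (@ent_term R).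
Proof.
apply: measurableT_comp => //; apply: measurable_funM => //.
Qed.

(** For [t = x * x] the product rule gives [2 * x * ent_term x], and the tangent at 1 bounds
    [ent_term x] by 1. *)
Lemma ent_term_sqrt t : 0 <= t -> ent_term t <= 2 * Num.sqrt t.
Proof.
suff h x : 0 <= x -> ent_term (x * x) <= 2 * x.
  by move=> t0; rewrite -{1}(sqr_sqrtr t0) expr2; apply: h; exact: sqrtr_ge0.
move=> x0; rewrite ent_termM//; have := ent_term_tangent ltr01 x0.
by rewrite ln1 => h; have h2 : ent_term x <= 1 by [lra]; nra.
Qed.

(** The tangent at [x + t], evaluated at [x], loses exactly [t]; what remains is a comparison of
    multiples of [ln (x + t)], which is nonpositive. *)
Lemma ent_term_modulus_lower x t : 0 <= x -> 0 <= t -> x + t <= 1 ->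
  ent_term x - t <= ent_term (x + t).
Proof.
rewrite le_eqVlt => /predU1P[<-|x0] t0 xt1.
  have := @ent_term_ge0 t; rewrite add0r ent_term0; lra.
have h := @ent_term_tangent (x + t) x (ltr_wpDr t0 x0) (ltW x0).
have h1 : ln (x + t) <= 0 by apply: ln_le0.
have h2 := mulr_ge0_le0 t0 h1; rewrite /ent_term in h *; nra.
Qed.

Lemma ent_term_modulus_upper x t : 0 <= x -> 0 <= t ->
  ent_term (x + t) <= ent_term x + ent_term t.
Proof.
rewrite le_eqVlt => /predU1P[<-|x0]; first by rewrite ent_term0 !add0r.
rewrite le_eqVlt => /predU1P[<-|t0]; first by rewrite ent_term0 !addr0.
have h1 : ln x <= ln (x + t) by rewrite ler_ln ?posrE ?addr_gt0//; lra.
have h2 : ln t <= ln (x + t) by rewrite ler_ln ?posrE ?addr_gt0//; lra.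
by rewrite /ent_term; nra.
Qed.

(** The derivative is unbounded at 0, so no Lipschitz bound holds; this explicit modulus gives
    uniform continuity on bit sequences in [bits_continuous_ent]. *)
Lemma ent_term_modulus x y : 0 <= x <= 1 -> 0 <= y <= 1 ->
  `|ent_term x - ent_term y| <= 2 * Num.sqrt `|x - y|.
Proof.
wlog xy : x y / x <= y.
  by move=> h hx hy; have [/h|/ltW/h] := leP x y; last rewrite distrC (distrC x); apply.
move=> /andP[x0 x1] /andP[y0 y1]; set t := y - x.
have t0 : 0 <= t by rewrite subr_ge0.
have -> : `|x - y| = t by rewrite distrC ger0_norm.
have ey : y = x + t by rewrite addrC subrK.
have := ent_term_modulus_upper x0 t0.
have := ent_term_modulus_lower x0 t0; rewrite -ey => /(_ y1) h1 h2.
have h3 := ent_term_sqrt t0.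
have t1 : t <= 1 by rewrite /t; lra.
have h4 : t <= Num.sqrt t.
  by rewrite -[leLHS](ger0_norm t0) -sqrtr_sqr ler_wsqrtr// expr2 ler_piMl.
have h5 := sqrtr_ge0 t.
rewrite ler_norml; lra.
Qed.

End ent_term_theory.

Section discrete_bool.

Let bool_measurable1 (b : bool) : measurable [set b].
Proof. by []. Qed.

(** As an alphabet, [bool] turns an event into a discrete variable, to which [joint_at] applies, and
    makes [cst true] available as the trivial variable. *)
HB.instance Definition _ := isDiscreteMeasurable.Build _ bool
  (countableP [set: bool]) bool_measurable1.

End discrete_bool.

(** * Countable sums under integrals *)

Section countable_esum.
Context (R : realType).

(** [D] and [g] do not depend on the terms [a]: one enumeration serves for a whole family of sums
    under an integral, to which the results on series of functions then apply. *)
Lemma countable_seriesP (E : pointedType) : countable [set: E] ->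
  exists (D : set nat) (g : nat -> E), forall a : E -> \bar R,
    (forall z, 0 <= a z) ->
    \esum_(z in [set: E]) a z = \sum_(n <oo) (if n \in D then a (g n) else 0).
Proof.
move=> /countable_bijP[D]; rewrite card_eq_sym => /card_set_bijP[/= g bg].
exists D, g => a a0; rewrite (reindex_esum D setT g)// esum_mkcond.
by rewrite nneseries_esumT// => n; case: ifP.
Qed.

Lemma integral_esum d (T : measurableType d) (mu : {measure set T -> \bar R})
    (E : pointedType) (f : E -> T -> \bar R) :
  countable [set: E] -> (forall z, measurable_fun [set: T] (f z)) ->
  (forall z t, 0 <= f z t) ->
  (\int[mu]_t \esum_(z in [set: E]) f z t) =
  \esum_(z in [set: E]) \int[mu]_t f z t.
Proof.
move=> cE mf f0; have [D [g Dg]] := countable_seriesP cE.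
rewrite Dg; last by move=> z; exact: integral_ge0.
under eq_integral => t _ do rewrite Dg//.
rewrite integral_nneseries//.
- apply: eq_eseriesr => n _; case: ifP => // _.
  by rewrite integral0_eq.
- by move=> n; case: (n \in D) => //; exact: measurable_cst.
- by move=> n t _; case: ifP.
Qed.

Lemma measurable_fun_esum d (T : measurableType d)
    (E : pointedType) (f : E -> T -> \bar R) :
  countable [set: E] -> (forall z, measurable_fun [set: T] (f z)) ->
  (forall z t, 0 <= f z t) ->
  measurable_fun [set: T] (fun t => \esum_(z in [set: E]) f z t).
Proof.
move=> cE mf f0; have [D [g Dg]] := countable_seriesP cE.
under eq_fun => t do rewrite Dg//.
apply: ge0_emeasurable_sum => //.
  by move=> n t _ _; case: ifP.
by move=> n _; case: (n \in D) => //; exact: measurable_cst.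
Qed.

(** The sum is a supremum over finite subsets, which may omit the negative terms. Such terms occur
    for [cond_pmf], whose values are not controlled on a null set. *)
Lemma esum_maxe0 (E : choiceType) (a : E -> \bar R) :
  \esum_(z in [set: E]) a z = \esum_(z in [set: E]) maxe (a z) 0.
Proof.
apply/eqP; rewrite eq_le; apply/andP; split.
  by apply: le_esum => z _; rewrite le_max lexx.
apply: ge_ereal_sup => _ [F [finF _] <-].
apply: esum_ge; exists (F `&` [set z | 0 <= a z]).
  by split => //; exact: finite_setIl.
rewrite fsbig_mkcondr; apply: lee_fsum => //= z zF.
case: ifPn; first by rewrite inE/= => az; rewrite ge_max lexx.
by rewrite notin_setE/= => /negP; rewrite -ltNge => /ltW az; rewrite ge_max lexx az.
Qed.

Lemma ae_countable_forall d (T : measurableType d) (mu : {measure set T -> \bar R})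
    (E : pointedType) (Q : E -> T -> Prop) : countable [set: E] ->
  (forall z, {ae mu, forall t, Q z t}) -> {ae mu, forall t, forall z, Q z t}.
Proof.
move=> /countable_bijP[D]; rewrite card_eq_sym => /card_set_bijP[/= g [_ _ sg]] aeQ.
apply: filterS (ae_foralln (fun n => aeQ (g n))) => t Qt z.
by have [n _ <-] := sg z I.
Qed.

End countable_esum.

(** * Versions of conditional probabilities *)

Section version.
Local Open Scope charge_scope.
Context d (W : measurableType d) (R : realType) (P : probability W R).
Context dT (T : measurableType dT) (U : {RV P >-> T}).

(** A version of P(M | U) with values in [0, 1] everywhere, whereas [cond_pmf] is constrained only
    almost everywhere. As [M] is any set, fibers, their intersections, rows and columns are treated
    alike. *)
Definition is_version (M : set W) (q : T -> R) :=
  [/\ measurable_fun [set: T] q, forall t, (0 <= q t <= 1)%R &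
      forall D, measurable D ->
        \int[distribution P U]_(t in D) (q t)%:E = P (M `&` U @^-1` D)].

Let mU (D : set T) : measurable D -> measurable (U @^-1` D).
Proof. by move=> mD; rewrite -[X in measurable X]setTI; exact: measurable_funPT. Qed.

Lemma integral_law (D : set T) (f : T -> \bar R) : measurable D ->
  measurable_fun D f -> {in D, forall t, 0 <= f t} ->
  \int[distribution P U]_(t in D) f t = \int[P]_(w in U @^-1` D) f (U w).
Proof. by move=> mD mf f0; rewrite ge0_integral_pushforward. Qed.

Lemma joint_at_dominated dE (E : discreteMeasurableType dE) (Z : {RV P >-> E}) z :
  joint_at Z U z `<< distribution P U.
Proof.
apply/null_content_dominatesP => D mD D0; apply/eqP.
rewrite eq_le measure_ge0 andbT -D0; apply: le_measure; rewrite ?inE//.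
  apply: measurableI; last exact: mU.
  by rewrite -[X in measurable X]setTI; apply: measurable_funPT => //;
    exact: discrete_measurable1.
exact: mU.
Qed.

Lemma cond_pmf_ae dE (E : discreteMeasurableType dE) (Z : {RV P >-> E}) z q :
  is_version (Z @^-1` [set z]) q ->
  {ae distribution P U, forall t, cond_pmf Z U z t = q t}.
Proof.
move=> [mq q01 qE].
have dom := @joint_at_dominated _ _ Z z.
have : ae_eq (distribution P U) setT
    ('d (charge_of_finite_measure (joint_at Z U z)) '/d (distribution P U))
    (EFin \o q).
  apply: integral_ae_eq => //; first exact: Radon_Nikodym_integrable.
    exact/measurable_EFinP.
  by move=> D _ mD; rewrite -Radon_Nikodym_integral//= qE.
by apply: filterS => t /(_ I) qt; rewrite /cond_pmf qt.
Qed.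

Let indicator (M : set W) (w : W) : bool := w \in M.

Section event.
Variables (M : set W) (mM : measurable M).

Let mind : measurable_fun [set: W] (indicator M).
Proof.
apply: (measurable_fun_bool true).
rewrite setTI (_ : _ @^-1` _ = M)//.
by apply/seteqP; split => w; [move=> /set_mem|move=> /mem_set].
Qed.

HB.instance Definition _ := isMeasurableFun.Build _ _ _ _ (indicator M) mind.

Let Zb : {RV P >-> bool} := indicator M.

Let ZbT : Zb @^-1` [set true] = M.
Proof. by apply/seteqP; split => w; [move=> /set_mem|move=> /mem_set]. Qed.

Let ZbF : Zb @^-1` [set false] = ~` M.
Proof.
apply/seteqP; split => w; rewrite /Zb /indicator /=; first by move/negbT; rewrite notin_setE.
by move=> Mw; apply/negbTE; rewrite notin_setE.
Qed.

Local Notation mu := (distribution P U).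
Let f b := Radon_Nikodym_SigmaFinite.f (joint_at Zb U b) mu.

Let f_dom b : joint_at Zb U b `<< mu. Proof. exact: joint_at_dominated. Qed.

Let f0 b t : 0 <= f b t. Proof. exact: Radon_Nikodym_SigmaFinite.f_ge0 (f_dom b) t. Qed.

Let mf b : measurable_fun setT (f b).
Proof. exact: measurable_int (Radon_Nikodym_SigmaFinite.f_integrable (f_dom b)). Qed.

Let f_int b D : measurable D -> \int[mu]_(t in D) f b t = joint_at Zb U b D.
Proof. by move=> mD; rewrite -(Radon_Nikodym_SigmaFinite.f_integral (f_dom b)). Qed.

(** The densities of [M] and of its complement add up to the density of the law of [U] with respect
    to itself, which is 1. *)
Let f_le1 : {ae mu, forall t, f true t <= 1}.
Proof.
have : ae_eq mu setT (cst 1) (f true \+ f false).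
  apply: integral_ae_eq => //.
  - by apply/integrableP; split => //; rewrite integral_cst//= normr1 mul1e
      probability_setT ltry.
  - exact: emeasurable_funD.
  - move=> D _ mD; rewrite integral_cst// mul1e.
    rewrite ge0_integralD//; do 1?exact: measurable_funTS.
    rewrite !f_int// /joint_at ZbT ZbF -measureU//.
    + by rewrite -setIUl setUv setTI.
    + by apply: measurableI => //; exact: mU.
    + by apply: measurableI; [exact: measurableC|exact: mU].
    + by rewrite setIACA setICr set0I.
by apply: filterS => t /(_ I) /= ->; rewrite leeDl.
Qed.

Lemma version_exists : exists q, is_version M q.
Proof.
(* By [f_le1], the cap changes the density on a null set only. *)
pose q t := Num.min 1%R (fine (f true t)).
have mq : measurable_fun setT q.
  by apply: measurable_funTS; apply: measurable_minr => //; exact: measurableT_comp.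
have q01 t : (0 <= q t <= 1)%R.
  by rewrite /q le_min ler01 fine_ge0//= ge_min lexx.
exists q; split => // D mD; rewrite -ZbT -[RHS]f_int//.
apply: ge0_ae_eq_integral => //.
- by apply: measurable_funTS; exact/measurable_EFinP.
- exact: measurable_funTS.
- by move=> t _; rewrite lee_fin; case/andP: (q01 t).
- apply: filterS f_le1 => t ft _.
  have ffin : f true t \is a fin_num.
    exact: Radon_Nikodym_SigmaFinite.f_fin_num (f_dom _) _.
  by rewrite -[RHS]fineK//; congr EFin; apply: min_r; rewrite -lee_fin fineK.
Qed.

(** Restricting [P] to [M] and pushing it forward by [U] gives [joint_at Zb U true], whose density
    with respect to the law of [U] is [q]. *)
Lemma integral_version q (phi : T -> \bar R) : is_version M q -> measurable_fun [set: T] phi ->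
  (forall t, 0 <= phi t) ->
  \int[P]_(w in M) phi (U w) = \int[distribution P U]_t (phi t * (q t)%:E).
Proof.
move=> [mq q01 qE] mphi phi0.
transitivity (\int[joint_at Zb U true]_t phi t).
  transitivity (\int[pushforward (mrestr P mM) U]_t phi t); last first.
    apply: eq_measure_integral => D mD _; rewrite /= /joint_at ZbT.
    by rewrite /pushforward /mrestr setIC.
  rewrite ge0_integral_pushforward//= preimage_setT -(setUv M).
  have mphiU : measurable_fun [set: W] (phi \o U) by exact: measurableT_comp.
  have mMC : measurable (~` M) by exact: measurableC.
  rewrite (ge0_integral_setU _ mM mMC); [|exact: measurable_funTS|
    by move=> w _; exact: phi0|exact/disj_setPCl].
  rewrite [X in _ = _ + X]null_set_integral ?adde0//; [|exact: measurable_funTS|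
    by rewrite /= /mrestr setICl measure0].
  by apply: eq_measure_integral => D mD DM; rewrite /= /mrestr setIidl.
rewrite -(Radon_Nikodym_SigmaFinite.change_of_variables (f_dom true))//.
apply: ge0_ae_eq_integral => //.
- by apply: emeasurable_funM => //; exact: (mf true).
- by apply: emeasurable_funM => //; exact/measurable_EFinP.
- by move=> t _; rewrite mule_ge0//; exact: f0.
- by move=> t _; rewrite mule_ge0// lee_fin; case/andP: (q01 t).
apply: (@filterS _ _ _ (fun t => f true t = (q t)%:E)) => [t ft _|]; first by rewrite -ft.
have : ae_eq mu setT (f true) (EFin \o q).
  apply: integral_ae_eq => //.
  - exact: (Radon_Nikodym_SigmaFinite.f_integrable (f_dom _)).
  - exact/measurable_EFinP.
  - by move=> D _ mD; rewrite f_int// qE// /joint_at ZbT.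
by apply: filterS => t /(_ I).
Qed.

End event.

(** Any versions will do, so later arguments choose convenient ones (constants, indicators,
    quotients, functions of bits) instead of handling Radon-Nikodym derivatives. *)
Lemma cond_entropyE dE (E : discreteMeasurableType dE) (Z : {RV P >-> E})
    (q : E -> T -> R) : (forall z, is_version (Z @^-1` [set z]) (q z)) ->
  cond_entropy Z U =
  \esum_(z in [set: E]) \int[distribution P U]_t (ent_term (q z t))%:E.
Proof.
move=> qv.
have cE : countable [set: E] := @discrete_countable _ E.
have ment (g : T -> R) : measurable_fun setT g ->
    measurable_fun setT (fun t => (ent_term (g t))%:E).
  move=> mg; apply/measurable_EFinP; apply: measurableT_comp => //.
  exact: measurable_ent_term.
have q0 z t : 0 <= (ent_term (q z t))%:E.
  by rewrite lee_fin ent_term_ge0//; have [] := qv z.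
rewrite -integral_esum//; last by move=> z; apply: ment; have [] := qv z.
transitivity (\int[distribution P U]_t
    \esum_(z in [set: E]) maxe (ent_term (cond_pmf Z U z t))%:E 0).
  by apply: eq_integral => t _; exact: esum_maxe0.
apply: ge0_ae_eq_integral => //.
- apply: measurable_fun_esum => //.
  + move=> z; apply: measurable_maxe => //; apply: ment.
    apply: measurableT_comp => //; apply: (measurable_int (distribution P U)).
    have dom := joint_at_dominated Z z; exact: Radon_Nikodym_integrable.
  + by move=> z t; rewrite le_max lexx orbT.
- by apply: measurable_fun_esum => // z; apply: ment; have [] := qv z.
- by move=> t _; apply: esum_ge0 => z _; rewrite le_max lexx orbT.
- by move=> t _; exact: esum_ge0.
apply: filterS (ae_countable_forall cE (fun z => cond_pmf_ae (qv z))) => t qt _.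
by apply: eq_esum => z _; rewrite qt; apply: max_l.
Qed.

End version.

(** * Conditional entropy *)

Section esum_extra.
Context (R : realType).

Lemma esumZl (E : pointedType) (a : E -> \bar R) (c : R) : countable [set: E] ->
  (0 <= c)%R -> (forall z, 0 <= a z) ->
  \esum_(z in [set: E]) (c%:E * a z) = c%:E * \esum_(z in [set: E]) a z.
Proof.
move=> cE c0 a0; have [D [g Dg]] := countable_seriesP R cE.
rewrite !Dg//; last by move=> z; rewrite mule_ge0.
rewrite -nneseriesZl//; last by move=> n _; case: ifP.
by apply: eq_eseriesr => n _; case: ifP => // _; rewrite mule0.
Qed.

Lemma esum_pair (E F : choiceType) (a : E -> F -> \bar R) :
  (forall z v, 0 <= a z v) ->
  \esum_(p in [set: E * F]) a p.1 p.2 =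
  \esum_(z in [set: E]) \esum_(v in [set: F]) a z v.
Proof.
move=> a0; rewrite esum_esum//; congr esum.
by apply/seteqP; split=> -[].
Qed.

Lemma esum_swap (E F : choiceType) (a : E * F -> \bar R) :
  \esum_(p in [set: E * F]) a p = \esum_(p in [set: F * E]) a (p.2, p.1).
Proof.
rewrite (reindex_esum [set: F * E] [set: E * F] (fun p => (p.2, p.1)))//.
split => // [[v z] [v' z'] _ _ [-> ->]//|[z v] _].
by exists (v, z).
Qed.

Lemma esum_single (E : choiceType) (a : E -> \bar R) z0 : 0 <= a z0 ->
  (forall z, z <> z0 -> a z = 0) -> \esum_(z in [set: E]) a z = a z0.
Proof.
move=> a0 az; rewrite -[RHS]esum_set1// [RHS]esum_mkcond; apply: eq_esum => z _.
by case: ifPn => //; rewrite notin_setE/= => /az.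
Qed.

(** Grouping property of entropy: apply the product rule [ent_termM] to [f z = g * r z], the weights
    [r z] having sum 1 unless [g = 0]. The cap at 1 is inactive here, since [f z <= g]; it keeps [r]
    in [0, 1] where that inequality fails, as it may on a null set in the chain rule. *)
Lemma ent_term_split (E : pointedType) (f : E -> R) (g : R) :
  countable [set: E] -> (forall z, (0 <= f z)%R) -> (0 <= g <= 1)%R ->
  \esum_(z in [set: E]) (f z)%:E = g%:E ->
  let r z := (if g == 0 then 0 else Num.min 1 (f z / g))%R in
  (forall z, f z = g * r z)%R /\
  \esum_(z in [set: E]) (ent_term (f z))%:E =
    (ent_term g)%:E + \esum_(z in [set: E]) (g * ent_term (r z))%:E.
Proof.
move=> cE f0 /andP[g0 g1] fg r.
have fleg z : (f z <= g)%R.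
  rewrite -lee_fin -fg -(@esum_set1 _ _ z (fun z => (f z)%:E)) ?lee_fin//.
  rewrite esum_mkcond; apply: le_esum => x _; case: ifPn => //.
  by rewrite lee_fin.
have rE z : (f z = g * r z)%R.
  rewrite /r; case: eqVneq => [g00|gn0].
    by rewrite g00 mul0r; apply/eqP; rewrite eq_le f0 -[X in (_ <= X)%R]g00 fleg.
  have gp : (0 < g)%R by rewrite lt_neqAle eq_sym gn0.
  by rewrite min_r ?ler_pdivrMr ?mul1r// mulrC divfK.
have r0 z : (0 <= r z <= 1)%R.
  rewrite /r; case: eqVneq => [_|gn0]; first by rewrite lexx ler01.
  by rewrite le_min ler01 divr_ge0//= ge_min lexx.
split => //.
have ent01 x : (0 <= x <= 1)%R -> 0 <= (ent_term x)%:E.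
  by move=> ?; rewrite lee_fin ent_term_ge0.
have entg : (0 <= ent_term g)%R by rewrite ent_term_ge0// g0.
have [r0' r1'] : (forall z, 0 <= r z)%R /\ (forall z, r z <= 1)%R.
  by split=> z; case/andP: (r0 z).
transitivity (\esum_(z in [set: E]) ((ent_term g * r z)%:E + (g * ent_term (r z))%:E)).
  by apply: eq_esum => z _; rewrite {1}rE ent_termM// EFinD mulrC.
rewrite esumD; last 2 first.
  by move=> z _; rewrite lee_fin mulr_ge0.
  by move=> z _; rewrite lee_fin mulr_ge0// ent_term_ge0.
congr (_ + _).
have [g00|gn0] := eqVneq g 0%R.
  by rewrite g00 ent_term0 esum1// => z _; rewrite mul0r.
transitivity (\esum_(z in [set: E]) ((ent_term g / g)%:E * (f z)%:E)).
  by apply: eq_esum => z _; rewrite -EFinM rE mulrA divfK.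
by rewrite esumZl ?divr_ge0// fg -EFinM divfK.
Qed.

End esum_extra.

Section conditional_entropy.
Context d (W : measurableType d) (R : realType) (P : probability W R).

Lemma measurable_fiber dE (E : discreteMeasurableType dE) (Z : {RV P >-> E}) z :
  measurable (Z @^-1` [set z]).
Proof.
by rewrite -[X in measurable X]setTI; apply: measurable_funPT => //;
  exact: discrete_measurable1.
Qed.

Lemma measurable_preim dT (T : measurableType dT) (U : {RV P >-> T}) D :
  measurable D -> measurable (U @^-1` D).
Proof. by move=> mD; rewrite -[X in measurable X]setTI; exact: measurable_funPT. Qed.

Lemma discrete_measurable dE (E : discreteMeasurableType dE) (D : set E) :
  measurable D.
Proof.
rewrite (_ : D = \bigcup_z (if z \in D then [set z] else set0)).
  apply: countable_bigcupT_measurable => [|z]; first exact: discrete_countable.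
  by case: ifP => // _; exact: discrete_measurable1.
apply/seteqP; split => [z Dz|z [x _]].
  by exists z => //; rewrite mem_set.
by case: ifPn => //; rewrite inE => Dx /= ->.
Qed.

Lemma versions_exist dE (E : discreteMeasurableType dE) (Z : {RV P >-> E})
    dT (T : measurableType dT) (U : {RV P >-> T}) :
  exists q : E -> T -> R, forall z, is_version U (Z @^-1` [set z]) (q z).
Proof.
have qz z := version_exists U (measurable_fiber Z z).
by exists (fun z => sval (cid (qz z))) => z; exact: svalP.
Qed.

Lemma integral_fibers dE (E : discreteMeasurableType dE) (Z : {RV P >-> E})
    (f : W -> \bar R) :
  measurable_fun [set: W] f -> (forall w, 0 <= f w) ->
  \int[P]_w f w = \esum_(z in [set: E]) \int[P]_(w in Z @^-1` [set z]) f w.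
Proof.
move=> mf f0.
transitivity (\int[P]_w \esum_(z in [set: E]) (f \_ (Z @^-1` [set z])) w).
  apply: eq_integral => w _; rewrite (@esum_single _ _ _ (Z w)).
  - by rewrite patchE mem_set.
  - exact: erestrict_ge0.
  - move=> z zZ; rewrite patchE memNset//= => Zwz; exact: zZ.
rewrite integral_esum//.
- by apply: eq_esum => z _; rewrite [RHS]integral_mkcond.
- exact: discrete_countable.
- move=> z; apply/(measurable_restrictT _ _).1; first exact: measurable_fiber.
  exact: measurable_funTS.
- by move=> z w; exact: erestrict_ge0.
Qed.

Lemma measure_fibers dE (E : discreteMeasurableType dE) (Z : {RV P >-> E}) A :
  measurable A -> P A = \esum_(z in [set: E]) P (Z @^-1` [set z] `&` A).
Proof.
move=> mA; transitivity (P (A `&` setT)); first by rewrite setIT.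
rewrite -integral_indic// (integral_fibers Z)//.
- apply: eq_esum => z _; rewrite integral_indic//; last exact: measurable_fiber.
  by rewrite (setIC A).
- by apply/measurable_EFinP; exact: measurable_indic.
Qed.

(** Total probability over the values of [Z], conditionally on [U]: the two functions have the same
    integral on every measurable set. *)
Lemma version_sum dE (E : discreteMeasurableType dE) (Z : {RV P >-> E})
    dT (T : measurableType dT) (U : {RV P >-> T}) M (q : E -> T -> R) g :
  measurable M -> is_version U M g ->
  (forall z, is_version U (Z @^-1` [set z] `&` M) (q z)) ->
  {ae distribution P U, forall t, \esum_(z in [set: E]) (q z t)%:E = (g t)%:E}.
Proof.
move=> mM [mg g01 gE] qv.
have cE : countable [set: E] := @discrete_countable _ E.
have mq z : measurable_fun setT (EFin \o q z).
  by apply/measurable_EFinP; case: (qv z).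
have q0 z t : 0 <= (q z t)%:E by rewrite lee_fin; case: (qv z) => _ /(_ t)/andP[].
suff : ae_eq (distribution P U) setT (EFin \o g)
    (fun t => \esum_(z in [set: E]) (q z t)%:E).
  by apply: filterS => t /(_ I) /= ->.
apply: integral_ae_eq => //.
- apply/integrableP; split; first exact/measurable_EFinP.
  apply: (@le_lt_trans _ _ (\int[distribution P U]_t (cst 1 t))); last first.
    by rewrite integral_cst//= mul1e probability_setT ltry.
  apply: ge0_le_integral => //.
    by do 2 apply: measurableT_comp => //.
  by move=> t _ /=; rewrite lee_fin ger0_norm; case/andP: (g01 t).
- exact: measurable_fun_esum.
- move=> D _ mD; rewrite gE//.
  rewrite integral_mkcond (_ : _ \_ D = fun t =>
      \esum_(z in [set: E]) ((fun t => (q z t)%:E) \_ D) t); last first.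
    apply/funext => t; rewrite patchE; case: ifPn => tD.
      by apply: eq_esum => z _; rewrite patchE tD.
    by rewrite esum1// => z _; rewrite patchE (negbTE tD).
  rewrite integral_esum//.
  + rewrite (measure_fibers Z); last by apply: measurableI => //; exact: measurable_preim.
    apply: eq_esum => z _; rewrite -integral_mkcond.
    by case: (qv z) => _ _ ->//; rewrite setIA.
  + move=> z; apply/(measurable_restrictT _ _).1 => //.
    exact: measurable_funTS (mq z).
  + by move=> z t; apply: erestrict_ge0 => ? _.
Qed.

Lemma measurable_discrete_fst dE (E : discreteMeasurableType dE)
    dT (T : measurableType dT) dT' (T' : measurableType dT') (h : E * T -> T') :
  (forall v, measurable_fun [set: T] (fun t => h (v, t))) ->
  measurable_fun [set: E * T] h.
Proof.
move=> mh _ D mD; rewrite setTI.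
rewrite (_ : _ @^-1` _ = \bigcup_v ([set v] `*` ((fun t => h (v, t)) @^-1` D))).
  apply: countable_bigcupT_measurable => [|v]; first exact: discrete_countable.
  apply: measurableX; first exact: discrete_measurable1.
  by rewrite -[X in measurable X]setTI; exact: mh.
apply/seteqP; split => [[v t] /= Dvt|[v t] [v' _ [/= -> //]]].
by exists v.
Qed.

Lemma measurable_pair_cst dE (E : measurableType dE) dT (T : measurableType dT) (v : E) :
  measurable_fun [set: T] (fun t : T => (v, t)).
Proof. by apply: measurable_fun_pair => //; exact: measurable_cst. Qed.

(** Disintegration: on the slice where [V] equals [v], the law of the pair has density [g v] with
    respect to the law of [U]. *)
Lemma integral_pair_law dF (F : discreteMeasurableType dF) (V : {RV P >-> F})
    dT (T : measurableType dT) (U : {RV P >-> T}) (g : F -> T -> R)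
    (phi : F * T -> \bar R) :
  (forall v, is_version U (V @^-1` [set v]) (g v)) ->
  measurable_fun [set: F * T] phi -> (forall s, 0 <= phi s) ->
  \int[distribution P (pairRV V U)]_s phi s =
  \esum_(v in [set: F]) \int[distribution P U]_t (phi (v, t) * (g v t)%:E).
Proof.
move=> gv mphi phi0.
rewrite integral_law//= preimage_setT (integral_fibers V)//; last first.
  by apply: measurableT_comp => //; exact: measurable_funPT.
apply: eq_esum => v _.
rewrite -(@integral_version _ _ _ _ _ _ U _ (measurable_fiber V v) (g v) (fun t => phi (v, t)))//.
  by apply: eq_integral => w; rewrite inE /= /pair_rv => ->.
by apply: measurableT_comp => //; exact: measurable_pair_cst.
Qed.

Lemma version_pullback dT (T : measurableType dT) dT' (T' : measurableType dT')
    (U : {RV P >-> T}) (V : {RV P >-> T'}) (phi : T' -> T) (psi : T -> T') M q :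
  measurable_fun [set: T'] phi -> measurable_fun [set: T] psi ->
  U =1 phi \o V -> V =1 psi \o U ->
  is_version U M q -> is_version V M (q \o phi).
Proof.
move=> mphi mpsi UV VU [mq q01 qE]; split => //=.
  exact: measurableT_comp.
have psiD D : measurable D -> measurable (psi @^-1` D).
  by move=> mD; rewrite -[X in measurable X]setTI; exact: mpsi.
have VUD D : V @^-1` D = U @^-1` (psi @^-1` D).
  by apply/seteqP; split => w /=; rewrite VU.
move=> D mD; rewrite VUD -qE; last exact: psiD.
rewrite [LHS]integral_law//; last 2 first.
- apply: measurable_funTS; apply/measurable_EFinP.
  exact: measurableT_comp.
- by move=> t _; rewrite lee_fin; case/andP: (q01 (phi t)).
rewrite [RHS]integral_law//; last 3 first.
- exact: psiD.
- by apply: measurable_funTS; exact/measurable_EFinP.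
- by move=> t _; rewrite lee_fin; case/andP: (q01 t).
by rewrite VUD; apply: eq_integral => w _; rewrite /= UV.
Qed.

Lemma measurable_ent_comp dT (T : measurableType dT) (q : T -> R) :
  measurable_fun [set: T] q ->
  measurable_fun [set: T] (fun t => (ent_term (q t))%:E).
Proof.
move=> mq; apply/measurable_EFinP; apply: measurableT_comp => //.
exact: measurable_ent_term.
Qed.

(** Variables that are functions of each other carry the same information: their versions correspond
    by composition. This serves to exchange components and to drop a constant one. *)
Lemma cond_entropy_pullback dE (E : discreteMeasurableType dE) (Z : {RV P >-> E})
    dT (T : measurableType dT) dT' (T' : measurableType dT')
    (U : {RV P >-> T}) (V : {RV P >-> T'}) (phi : T' -> T) (psi : T -> T') :
  measurable_fun [set: T'] phi -> measurable_fun [set: T] psi ->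
  U =1 phi \o V -> V =1 psi \o U ->
  cond_entropy Z U = cond_entropy Z V.
Proof.
move=> mphi mpsi UV VU; have [q qv] := versions_exist Z U.
have qv' z := version_pullback mphi mpsi UV VU (qv z).
rewrite (cond_entropyE qv) (cond_entropyE qv').
apply: eq_esum => z _; have [mq q01 _] := qv z.
rewrite [LHS]integral_law//; last 2 first.
- exact: measurable_ent_comp.
- by move=> t _; rewrite lee_fin ent_term_ge0.
rewrite [RHS]integral_law//; last 2 first.
- by apply: (@measurable_ent_comp _ _ (q z \o phi)); exact: measurableT_comp.
- by move=> t _; rewrite lee_fin ent_term_ge0/=.
by rewrite !preimage_setT; apply: eq_integral => w _; rewrite /= UV.
Qed.

(** The versions are constant functions. Unconditional statements thus become conditional ones with
    a trivial condition. *)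
Lemma cond_entropy_cst dE (E : discreteMeasurableType dE) (Z : {RV P >-> E})
    dT (T : measurableType dT) (t0 : T) :
  cond_entropy Z (cst t0 : {RV P >-> T}) = entropy Z.
Proof.
pose q z (t : T) := fine (P (Z @^-1` [set z])).
have Pfin A : measurable A -> P A \is a fin_num by move=> mA; exact: fin_num_measure.
have qv z : is_version (cst t0 : {RV P >-> T}) (Z @^-1` [set z]) (q z).
  split.
  - exact: measurable_cst.
  - move=> t; rewrite fine_ge0//= -lee_fin fineK ?probability_le1//.
      exact: measurable_fiber.
    by apply: Pfin; exact: measurable_fiber.
  - move=> D mD; rewrite /q integral_cst//= fineK; last by apply: Pfin; exact: measurable_fiber.
    rewrite /distribution/pushforward preimage_cst; case: ifPn => _.
      by rewrite setIT probability_setT mule1.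
    by rewrite setI0 measure0 mule0.
rewrite (cond_entropyE qv); apply: eq_esum => z _.
by rewrite /q integral_cst//= probability_setT mule1.
Qed.

(** Indicators are versions, and [ent_term] vanishes at 0 and 1. *)
Lemma cond_entropy_fun dE (E : discreteMeasurableType dE) (Z : {RV P >-> E})
    dT (T : measurableType dT) (U : {RV P >-> T}) (phi : T -> E) :
  measurable_fun [set: T] phi -> Z =1 phi \o U -> cond_entropy Z U = 0.
Proof.
move=> mphi ZU; pose q z := (\1_(phi @^-1` [set z]) : T -> R).
have mz z : measurable (phi @^-1` [set z]).
  by rewrite -[X in measurable X]setTI; apply: mphi => //; exact: discrete_measurable1.
have qv z : is_version U (Z @^-1` [set z]) (q z).
  split.
  - exact: measurable_indic.
  - by move=> t; rewrite /q indicE; case: (_ \in _); rewrite ler01 lexx.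
  - move=> D mD; rewrite integral_indic//= /distribution /pushforward.
    by rewrite preimage_setI; congr (P (_ `&` _)); apply/seteqP; split => w /=; rewrite ZU.
rewrite (cond_entropyE qv); apply: esum1 => z _.
rewrite integral0_eq// => t _; rewrite /q indicE.
by case: (_ \in _); rewrite ?ent_term1 ?ent_term0.
Qed.

(* Jensen's inequality, via the tangent line of [ent_term] at [P M]. *)
Lemma integral_ent_term_le dT (T : measurableType dT) (U : {RV P >-> T}) M q :
  measurable M -> is_version U M q ->
  \int[distribution P U]_t (ent_term (q t))%:E <= (ent_term (fine (P M)))%:E.
Proof.
move=> mM [mq q01 qE].
have qint : \int[distribution P U]_t (q t)%:E = P M.
  by rewrite qE// preimage_setT setIT.
have PM : P M \is a fin_num by exact: fin_num_measure.
have q0 t : 0 <= (q t)%:E by rewrite lee_fin; case/andP: (q01 t).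
have mqE : measurable_fun setT (EFin \o q) by exact/measurable_EFinP.
have ent0 t : 0 <= (ent_term (q t))%:E by rewrite lee_fin ent_term_ge0.
set p := fine (P M); have pE : P M = p%:E by rewrite fineK.
have : (0 <= p)%R by rewrite fine_ge0.
have p1 : (p <= 1)%R by rewrite -lee_fin -pE probability_le1.
(* The graph has no tangent of finite slope at 0; when [P M] vanishes, [q] is 0 almost everywhere
   instead. *)
rewrite le_eqVlt => /predU1P[p0|p0].
  have : ae_eq (distribution P U) setT (EFin \o q) (cst 0).
    apply/ae_eq_integral_abs => //.
    transitivity (\int[distribution P U]_t (q t)%:E); last by rewrite qint pE -p0.
    by apply: eq_integral => t _; rewrite /= ger0_norm//; case/andP: (q01 t).
  move=> q_0; rewrite (@ge0_ae_eq_integral _ _ _ _ _ _ (cst 0))//.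
  - by rewrite integral0 -p0 ent_term0.
  - exact: measurable_ent_comp.
  - by apply: filterS q_0 => t /(_ I) /= [->] _; rewrite ent_term0.
have lnp : (0 <= - ln p)%R by rewrite oppr_ge0 ln_le0.
have : \int[distribution P U]_t ((ent_term (q t))%:E + (q t)%:E) <=
       \int[distribution P U]_t ((- ln p)%:E * (q t)%:E + p%:E).
  apply: ge0_le_integral => //.
  - by move=> t _; rewrite adde_ge0.
  - by apply: emeasurable_funD => //; exact: measurable_ent_comp.
  - apply: emeasurable_funD; last exact: measurable_cst.
    by apply: emeasurable_funM => //; exact: measurable_cst.
  - move=> t _; rewrite -EFinM -!EFinD lee_fin ent_term_tangent//.
    by case/andP: (q01 t).
rewrite ge0_integralD//; last exact: measurable_ent_comp.
rewrite ge0_integralD//; last 3 first.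
- by move=> t _; rewrite mule_ge0.
- by apply: emeasurable_funM => //; exact: measurable_cst.
- by move=> t _; rewrite lee_fin ltW.
rewrite ge0_integralZl// integral_cst//= probability_setT mule1 qint pE.
by rewrite leeD2rE// -EFinM /ent_term mulrC mulrN.
Qed.

Lemma cond_entropy_le dE (E : discreteMeasurableType dE) (Z : {RV P >-> E})
    dT (T : measurableType dT) (U : {RV P >-> T}) :
  cond_entropy Z U <= entropy Z.
Proof.
have [q qv] := versions_exist Z U; rewrite (cond_entropyE qv).
apply: le_esum => z _; apply: integral_ent_term_le (qv z).
exact: measurable_fiber.
Qed.

Lemma cond_entropy_ge0 dE (E : discreteMeasurableType dE) (Z : {RV P >-> E})
    dT (T : measurableType dT) (U : {RV P >-> T}) :
  0 <= cond_entropy Z U.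
Proof.
have [q qv] := versions_exist Z U; rewrite (cond_entropyE qv).
apply: esum_ge0 => z _; apply: integral_ge0 => t _.
by rewrite lee_fin ent_term_ge0//; case: (qv z).
Qed.

Lemma measurable_EFin_patch dT (T : measurableType dT) (D : set T) (f : T -> R) :
  measurable D -> measurable_fun [set: T] f ->
  measurable_fun [set: T] ((fun t => (f t)%:E) \_ D).
Proof.
move=> mD mf; apply/(measurable_restrictT _ _).1 => //.
by apply: (@measurable_funTS _ _ _ _ _ (EFin \o f)); exact/measurable_EFinP.
Qed.

(** The versions of [Z] given (V, U) are quotients [r] of those of (Z, V) and of [V] given [U]. The
    grouping property then gives the equality for each [v], at almost every value of [U]. *)
Lemma cond_entropy_chain dE (E : discreteMeasurableType dE) (Z : {RV P >-> E})
    dF (F : discreteMeasurableType dF) (V : {RV P >-> F})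
    dT (T : measurableType dT) (U : {RV P >-> T}) :
  cond_entropy (pairRV Z V) U = cond_entropy V U + cond_entropy Z (pairRV V U).
Proof.
have [f fv] := versions_exist (pairRV Z V) U.
have [g gv] := versions_exist V U.
have cE : countable [set: E] := @discrete_countable _ E.
have cF : countable [set: F] := @discrete_countable _ F.
have [mf f01] : (forall p, measurable_fun setT (f p)) /\
    (forall p t, 0 <= f p t <= 1)%R by split=> p; case: (fv p).
have [mg g01] : (forall v, measurable_fun setT (g v)) /\
    (forall v t, 0 <= g v t <= 1)%R by split=> v; case: (gv v).
have f0 p t : (0 <= f p t)%R by case/andP: (f01 p t).
have g0 v t : (0 <= g v t)%R by case/andP: (g01 v t).
have fv' z v : is_version U (Z @^-1` [set z] `&` V @^-1` [set v]) (f (z, v)).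
  rewrite (_ : _ `&` _ = pairRV Z V @^-1` [set (z, v)])//.
  by apply/seteqP; split => [w /= [<- <-]//|w /= [-> ->]].
have fg : {ae distribution P U, forall t,
    forall v, \esum_(z in [set: E]) (f (z, v) t)%:E = (g v t)%:E}.
  apply: ae_countable_forall => // v.
  exact: version_sum (measurable_fiber V v) (gv v) (fv' ^~ v).
pose r z (s : F * T) := (if g s.1 s.2 == 0 then 0
  else Num.min 1 (f (z, s.1) s.2 / g s.1 s.2))%R.
have r01 z s : (0 <= r z s <= 1)%R.
  rewrite /r; case: eqVneq => [_|gn0]; first by rewrite lexx ler01.
  by rewrite le_min ler01 divr_ge0//= ge_min lexx.
have mr z : measurable_fun [set: F * T] (r z).
  apply: measurable_discrete_fst => v; rewrite /r /=.
  apply: measurable_fun_if => //.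
  - exact: measurable_fun_eqr.
  - apply: measurable_funTS; apply: measurable_minr => //.
    rewrite (_ : (fun _ => _) = (fun t => f (z, v) t * g v t `^ (-1)))%R; last first.
      by apply/funext => t; rewrite powR_inv1.
    apply: measurable_funM => //.
    by apply: (@measurableT_comp _ _ _ _ _ _ (fun x => x `^ (-1))%R) => //; exact: measurable_powR.
have rv z : is_version (pairRV V U) (Z @^-1` [set z]) (r z).
  split => // D mD.
  rewrite integral_mkcond (integral_pair_law gv); last 2 first.
  - exact: measurable_EFin_patch.
  - by move=> s; apply: erestrict_ge0 => x _; rewrite lee_fin; case/andP: (r01 z x).
  rewrite (measure_fibers V); last first.
    apply: measurableI; first exact: measurable_fiber.
    exact: measurable_preim.
  apply: eq_esum => v _.
  have mDv : measurable ((fun t : T => (v, t)) @^-1` D).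
    by rewrite -[X in measurable X]setTI; exact: measurable_pair_cst.
  transitivity (P (Z @^-1` [set z] `&` V @^-1` [set v] `&`
      U @^-1` ((fun t => (v, t)) @^-1` D))); last first.
    congr (P _); apply/seteqP; split => w /=.
      by move=> [[zw vw] Dw]; split => //; split => //; rewrite /pair_rv vw.
    by rewrite /pair_rv => -[vw [zw]]; rewrite vw.
  have [_ _ <-//] := fv' z v.
  rewrite [RHS]integral_mkcond; apply: ge0_ae_eq_integral => //.
  - apply: emeasurable_funM; last exact/measurable_EFinP.
    apply: (@measurableT_comp _ _ _ _ _ _ ((fun s => (r z s)%:E) \_ D)).
      exact: measurable_EFin_patch.
    exact: measurable_pair_cst.
  - exact: measurable_EFin_patch.
  - move=> t _; rewrite mule_ge0 ?lee_fin//; apply: erestrict_ge0 => x _.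
    by rewrite lee_fin; case/andP: (r01 z x).
  - by move=> t _; apply: erestrict_ge0 => ? _; rewrite lee_fin.
  - apply: filterS fg => t fgt _; rewrite !patchE.
    have [fr _] := ent_term_split cE (fun z => f0 (z, v) t) (g01 v t) (fgt v).
    have -> : (t \in (fun t => (v, t)) @^-1` D) = ((v, t) \in D).
      by apply/idP/idP => /set_mem/= ?; apply/mem_set.
    by case: ifPn => _; rewrite ?mul0e// -EFinM mulrC [in RHS]fr.
rewrite (cond_entropyE fv) (cond_entropyE gv) (cond_entropyE rv).
rewrite (@esum_swap _ E F) (@esum_pair _ F E (fun v z =>
  \int[distribution P U]_t (ent_term (f (z, v) t))%:E)); last first.
  by move=> v z; apply: integral_ge0 => t _; rewrite lee_fin ent_term_ge0.
(* The law of (V, U) is disintegrated and the sum over [z] moved inside, so that the grouping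
   property can compare integrands for fixed [v]. *)
have -> : \esum_(z in [set: E]) \int[distribution P (pairRV V U)]_s
    (ent_term (r z s))%:E = \esum_(v in [set: F]) \esum_(z in [set: E])
    \int[distribution P U]_t (g v t * ent_term (r z (v, t)))%:E.
  rewrite -(@esum_pair _ F E (fun v z => \int[distribution P U]_t
    (g v t * ent_term (r z (v, t)))%:E)); last first.
    by move=> v z; apply: integral_ge0 => t _; rewrite lee_fin mulr_ge0// ent_term_ge0.
  rewrite (@esum_swap _ F E) (@esum_pair _ E F (fun z v => \int[distribution P U]_t
    (g v t * ent_term (r z (v, t)))%:E)); last first.
    by move=> z v; apply: integral_ge0 => t _; rewrite lee_fin mulr_ge0// ent_term_ge0.
  apply: eq_esum => z _; rewrite (integral_pair_law gv); last 2 first.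
  - exact: measurable_ent_comp.
  - by move=> s; rewrite lee_fin ent_term_ge0.
  apply: eq_esum => v _; apply: eq_integral => t _.
  by rewrite -EFinM mulrC.
rewrite -esumD; last 2 first.
- by move=> v _; apply: integral_ge0 => t _; rewrite lee_fin ent_term_ge0.
- move=> v _; apply: esum_ge0 => z _; apply: integral_ge0 => t _.
  by rewrite lee_fin mulr_ge0// ent_term_ge0.
have mrv z v : measurable_fun setT (fun t => r z (v, t)).
  by apply: measurableT_comp => //; exact: measurable_pair_cst.
have mgr z v : measurable_fun setT (fun t => (g v t * ent_term (r z (v, t)))%:E).
  apply/measurable_EFinP; apply: measurable_funM => //.
  by apply: measurableT_comp => //; exact: measurable_ent_term.
have gr0 z v t : 0 <= (g v t * ent_term (r z (v, t)))%:E.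
  by rewrite lee_fin mulr_ge0// ent_term_ge0.
have mef z v : measurable_fun setT (fun t => (ent_term (f (z, v) t))%:E).
  exact: measurable_ent_comp.
have ef0 z v t : 0 <= (ent_term (f (z, v) t))%:E by rewrite lee_fin ent_term_ge0.
apply: eq_esum => v _.
rewrite -integral_esum// -[X in _ + X]integral_esum//.
rewrite -ge0_integralD//; last 4 first.
- by move=> t _; rewrite lee_fin ent_term_ge0.
- exact: measurable_ent_comp.
- by move=> t _; exact: esum_ge0.
- exact: measurable_fun_esum.
apply: ge0_ae_eq_integral => //.
- exact: measurable_fun_esum.
- apply: emeasurable_funD; first exact: measurable_ent_comp.
  exact: measurable_fun_esum.
- by move=> t _; exact: esum_ge0.
- by move=> t _; rewrite adde_ge0 ?lee_fin ?ent_term_ge0//; exact: esum_ge0.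
- apply: filterS fg => t fgt _.
  by have [_ ->] := ent_term_split cE (fun z => f0 (z, v) t) (g01 v t) (fgt v).
Qed.

Lemma cond_entropy_pairC dE (E : discreteMeasurableType dE) (Z : {RV P >-> E})
    dF (F : discreteMeasurableType dF) (V : {RV P >-> F})
    dT (T : measurableType dT) (U : {RV P >-> T}) :
  cond_entropy (pairRV Z V) U = cond_entropy (pairRV V Z) U.
Proof.
have [f fv] := versions_exist (pairRV Z V) U.
have fv' p : is_version U (pairRV V Z @^-1` [set p]) (f (p.2, p.1)).
  rewrite (_ : _ @^-1` _ = pairRV Z V @^-1` [set (p.2, p.1)])//.
  by apply/seteqP; split => w; rewrite /= /pair_rv; case: p => v z /= [-> ->].
by rewrite (cond_entropyE fv) (cond_entropyE fv') (@esum_swap _ E F).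
Qed.

Lemma cond_entropy_discrete dE (E : discreteMeasurableType dE) (Z : {RV P >-> E})
    dF (F : discreteMeasurableType dF) (V : {RV P >-> F}) :
  entropy (pairRV Z V) = entropy V + cond_entropy Z V.
Proof.
pose c : {RV P >-> bool} := cst true.
rewrite -(cond_entropy_cst (pairRV Z V) true) -(cond_entropy_cst V true).
rewrite cond_entropy_chain; congr (_ + _).
by apply: (@cond_entropy_pullback _ _ _ _ _ _ _ _ _ (fun v => (v, true)) fst) => //.
Qed.

Lemma cond_entropy_condC dE (E : discreteMeasurableType dE) (Z : {RV P >-> E})
    dF (F : discreteMeasurableType dF) (V : {RV P >-> F})
    dT (T : measurableType dT) (U : {RV P >-> T}) :
  cond_entropy Z (pairRV V U) = cond_entropy Z (pairRV U V).
Proof.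
by apply: (@cond_entropy_pullback _ _ _ _ _ _ _ _ _ (fun p => (p.2, p.1))
  (fun p => (p.2, p.1))) => //;
  apply: measurable_fun_pair.
Qed.

End conditional_entropy.

(** * Random bits with prescribed cylinder probabilities *)

Section nested_intervals.
Context (R : realType) (m : seq bool -> R).
Hypothesis m_ge0 : forall w, (0 <= m w)%R.
Hypothesis m_nil : (m [::] = 1)%R.
Hypothesis m_rcons : forall w, (m w = m (rcons w false) + m (rcons w true))%R.
Local Open Scope ring_scope.

(** State of a binary search for [x]: the left end of the current interval and the word naming it.
    The interval is split at [a]. *)
Let step (p : R * seq bool) (x : R) : R * seq bool :=
  let a := p.1 + m (rcons p.2 false) in
  if x < a then (p.1, rcons p.2 false) else (a, rcons p.2 true).

Let descent (k : nat) (x : R) := iteri k (fun _ p => step p x) (0, [::]).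

Let dbit x n := last false (descent n.+1 x).2.

(** Each bit [true] skips the left half of the interval reached so far; the left end is the total
    mass skipped. *)
Let left_end (w : seq bool) :=
  \sum_(i < size w | nth false w i) m (rcons (take i w) false).

Let descent_word k (x : R) : (descent k x).2 = mkseq (dbit x) k.
Proof.
elim: k => [//|k IH]; rewrite mkseqS -IH /dbit /=.
by rewrite /step; case: ifP => _ /=; rewrite last_rcons.
Qed.

Let left_end_rcons w c :
  left_end (rcons w c) = left_end w + (if c then m (rcons w false) else 0).
Proof.
rewrite /left_end !(big_mkcond (fun i => nth _ _ _)) size_rcons big_ord_recr /=.
rewrite nth_rcons ltnn eqxx -cats1 take_size_cat//; congr (_ + _).
by apply: eq_bigr => i _; rewrite takel_cat ?(ltnW (ltn_ord i))// nth_cat ltn_ord.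
Qed.

Let descent_left k (x : R) : (descent k x).1 = left_end (descent k x).2.
Proof.
elim: k => [|k IH]; first by rewrite /left_end big_ord0.
rewrite /= /step; case: ifP => _ /=; rewrite left_end_rcons -IH//.
by rewrite addr0.
Qed.

Let descent_mem k (x : R) : 0 <= x < 1 ->
  (descent k x).1 <= x < (descent k x).1 + m (descent k x).2.
Proof.
move=> x01; elim: k => [|k /andP[IH1 IH2]]; first by rewrite m_nil add0r.
rewrite /= /step; case: ltP => xa /=; rewrite ?IH1 ?xa//=.
by rewrite -addrA -m_rcons.
Qed.

Let cell_sub w c (x : R) :
  left_end (rcons w c) <= x < left_end (rcons w c) + m (rcons w c) ->
  left_end w <= x < left_end w + m w.
Proof.
rewrite left_end_rcons (m_rcons w) => /andP[].
have := m_ge0 (rcons w false); have := m_ge0 (rcons w true).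
by case: c => *; apply/andP; split; lra.
Qed.

Let mem_descent w (x : R) : left_end w <= x < left_end w + m w ->
  0 <= x < 1 /\ (descent (size w) x).2 = w.
Proof.
elim/last_ind: w => [|w c IH]; first by rewrite /left_end big_ord0 m_nil add0r.
move=> xwc; have /cell_sub/IH[x01 xw] := xwc; split => //.
rewrite size_rcons /= /step descent_left xw.
move: xwc; rewrite left_end_rcons.
by case: c => /andP[h1 h2];
  case: (ltP x (left_end w + m (rcons w false))) => //= h3;
  clear xw IH; exfalso; lra.
Qed.

(** Bits are [false] outside [0, 1[, so that the set where a bit is [true] is a countable union of
    intervals of words. *)
Let bit (x : R) n := (0 <= x < 1) && dbit x n.

Let cellE w : [set x | mkseq (bit x) (size w) = w] `&` `[0, 1[ =
  `[left_end w, left_end w + m w[%classic.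
Proof.
have bitE x k : 0 <= x < 1 -> mkseq (bit x) k = (descent k x).2.
  by move=> x01; rewrite descent_word; apply: eq_mkseq => n; rewrite /bit x01.
apply/seteqP; split => x /=; rewrite !in_itv/=.
  move=> [xw x01]; move: xw; rewrite bitE// => xw.
  by have := descent_mem (size w) x01; rewrite descent_left xw.
by move=> /mem_descent[x01 xw]; rewrite bitE.
Qed.

Let mbit n : measurable [set x : R | bit x n].
Proof.
rewrite (_ : [set _ | _] = \bigcup_(w : seq bool)
    (if (size w == n.+1) && last false w then
      `[left_end w, left_end w + m w[%classic else set0)).
  apply: countable_bigcupT_measurable; first exact: countableP.
  by move=> w; case: ifP => // _; exact: measurable_itv.
apply/seteqP; split => [x xn|x [w _]]; last first.
  case: ifPn => // /andP[/eqP sw lw]; rewrite -cellE sw /= => -[xw _].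
  move: lw; rewrite -xw mkseqS last_rcons//.
have x01 : 0 <= x < 1 by move: xn => /= /andP[].
exists (mkseq (bit x) n.+1) => //; rewrite ifT.
  suff : (`[left_end (mkseq (bit x) n.+1), left_end (mkseq (bit x) n.+1) +
      m (mkseq (bit x) n.+1)[%classic) x by [].
  rewrite -cellE; split; last by rewrite /= in_itv.
  by rewrite /mkset size_mkseq.
by rewrite size_mkseq eqxx mkseqS last_rcons.
Qed.

Lemma measurable_mkseq d (T : measurableType d) (b : T -> nat -> bool) w :
  (forall n, measurable [set x | b x n]) ->
  measurable [set x | mkseq (b x) (size w) = w].
Proof.
move=> mb; elim/last_ind: w => [|w c IH]; first by rewrite (_ : mkset _ = setT)//; apply/seteqP.
rewrite (_ : mkset _ = [set x | mkseq (b x) (size w) = w] `&`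
    [set x | b x (size w) = c]).
  apply: measurableI => //; case: c; first exact: mb.
  rewrite (_ : mkset _ = ~` [set x | b x (size w)]); first exact: measurableC.
  by apply/seteqP; split => x /=; case: (b x (size w)).
apply/seteqP; split => x /=; rewrite size_rcons mkseqS.
  by move/rcons_inj => [].
by move=> [-> ->].
Qed.

Let uniform_itv (a b : R) : 0 <= a -> a <= b -> b <= 1 ->
  uniform_prob (@ltr01 R) `[a, b[ = (b - a)%:E.
Proof.
move=> a0 ab b1; rewrite /uniform_prob.
rewrite (eq_integral (cst 1%E)).
  rewrite integral_cst//= mul1e lebesgue_measure_itv/= lte_fin.
  by case: ltP => // ba; rewrite (@le_anti _ _ a b) ?ab// subrr.
move=> x; rewrite inE/= in_itv/= => /andP[ax xb]; rewrite /uniform_pdf.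
by rewrite subr0 invr1 ifT//; apply/andP; split; lra.
Qed.

(* A consistent family [m] of cylinder probabilities is realized on [0, 1) by
   splitting the interval of a word [w], of length [m w], into the intervals of
   its two successors. *)
Lemma random_bits_exist : exists b : R -> nat -> bool,
  (forall n, measurable [set x | b x n]) /\
  forall w, uniform_prob (@ltr01 R) [set x | mkseq (b x) (size w) = w] = (m w)%:E.
Proof.
exists bit; split; [exact: mbit|move=> w].
have mw : measurable [set x | mkseq (bit x) (size w) = w] by exact: measurable_mkseq.
have m01 : measurable (`[0, 1[%classic : set R) by exact: measurable_itv.
rewrite -[X in uniform_prob _ X](setUIDK _ `[0, 1[%classic) measureU; last 3 first.
- exact: measurableI.
- exact: measurableD.
- by rewrite setDE setIACA setICr setI0.
(* The uniform law does not charge the complement of [0, 1[; what remains is the interval of [w], of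
   length [m w]. *)
rewrite [X in _ + X](_ : _ = 0)%E; last first.
  apply/eqP; rewrite eq_le measure_ge0 andbT.
  apply: (@le_trans _ _ (uniform_prob (@ltr01 R) (~` `[0, 1[%classic))).
    by apply: le_measure; rewrite ?inE;
      [exact: measurableD|exact: measurableC|exact: subDsetr].
  rewrite probability_setC//= [X in (_ - X)%E](_ : _ = 1%E) ?subee//.
  by rewrite uniform_itv// subr0.
rewrite adde0 cellE.
transitivity (uniform_prob (@ltr01 R) `[left_end w, left_end w + m w[) => //.
rewrite uniform_itv.
- by rewrite addrC addKr.
- by rewrite /left_end sumr_ge0.
- by rewrite lerDl.
- elim/last_ind: w {mw} => [|w c IH]; first by rewrite /left_end big_ord0 m_nil add0r.
  apply: le_trans IH; rewrite left_end_rcons (m_rcons w).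
  have := m_ge0 (rcons w false); have := m_ge0 (rcons w true).
  by case: c; lra.
Qed.

End nested_intervals.

(** * Binary expansions *)

Section binary_digits.
Context (R : realType).
Local Open Scope ring_scope.
Implicit Types (c : nat -> bool) (x : R).

Definition dyadic_sum c (J : nat) : R := \sum_(j < J) (c j)%:R * 2^-1 ^+ j.+1.

Definition dyadic c : R := sup [set dyadic_sum c J | J in [set: nat]].

Let dyadic_sum_le c J K : (J <= K)%N ->
  dyadic_sum c J <= dyadic_sum c K /\
  dyadic_sum c K + 2^-1 ^+ K <= dyadic_sum c J + 2^-1 ^+ J.
Proof.
move=> JK; rewrite -(subnK JK); elim: (K - J)%N => [|n [IH1 IH2]] //.
rewrite addSn /dyadic_sum !big_ord_recr /= -!/(dyadic_sum _ _).
have p0 : 0 < 2^-1 ^+ (n + J) :> R by rewrite exprn_gt0.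
rewrite exprS; split.
  by apply: (le_trans IH1); case: (c _); rewrite ?mul1r ?mul0r; lra.
by apply: le_trans IH2; case: (c _); rewrite ?mul1r ?mul0r; lra.
Qed.

Lemma dyadic_approx c J :
  dyadic_sum c J <= dyadic c <= dyadic_sum c J + 2^-1 ^+ J.
Proof.
have ub K : dyadic_sum c K <= dyadic_sum c J + 2^-1 ^+ J.
  have p0 n : 0 < 2^-1 ^+ n :> R by rewrite exprn_gt0.
  have := p0 K; have := p0 J.
  by have [/ltnW/(dyadic_sum_le c)[]|/(dyadic_sum_le c)[]] := ltnP J K; lra.
apply/andP; split.
  apply: ub_le_sup; last by exists J.
  by exists (dyadic_sum c J + 2^-1 ^+ J) => _ [K _ <-].
apply: ge_sup; first by exists (dyadic_sum c 0), 0%N.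
by move=> _ [K _ <-].
Qed.

(** The doubling map on the closed interval [0, 1]: the point 1 is fixed and has all its digits
    [true], so it needs no separate treatment. *)
Fixpoint remainder x (j : nat) : R :=
  if j is j'.+1 then 2 * remainder x j' - (2^-1 <= remainder x j')%R%:R else x.

Definition digit x (j : nat) : bool := 2^-1 <= remainder x j.

Lemma remainder01 x j : 0 <= x <= 1 -> 0 <= remainder x j <= 1.
Proof.
move=> x01; elim: j => [//|j /andP[IH1 IH2]] /=.
by case: (leP 2^-1 (remainder x j)) => /= h; apply/andP; split; lra.
Qed.

Lemma dyadic_sum_digit x J : dyadic_sum (digit x) J = x - 2^-1 ^+ J * remainder x J.
Proof.
elim: J => [|J IH]; first by rewrite /dyadic_sum big_ord0 /= expr0 mul1r subrr.
rewrite /dyadic_sum big_ord_recr /= -/(dyadic_sum _ _) IH /digit.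
by rewrite exprS; field.
Qed.

Lemma half_expn_small (e : R) : 0 < e -> exists J, 2^-1 ^+ J <= e :> R.
Proof.
move=> e0; have [J _ /(_ J (leqnn J))/=] := near_infty_natSinv_expn_lt (PosNum e0).
by rewrite div1r -exprVn => /ltW; exists J.
Qed.

Lemma dyadic_digit x : 0 <= x <= 1 -> dyadic (digit x) = x.
Proof.
move=> x01; apply/eqP; rewrite -subr_eq0 -normr_le0; apply/ler_addgt0Pr => e e0.
have [J Je] := half_expn_small e0; rewrite add0r; apply: le_trans Je.
have := dyadic_approx (digit x) J; rewrite dyadic_sum_digit.
have /andP[r0 r1] := remainder01 J x01.
have p0 : 0 < 2^-1 ^+ J :> R by rewrite exprn_gt0.
move=> /andP[h1 h2]; rewrite ler_norml; apply/andP; split; nra.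
Qed.

Lemma dyadic01 c : 0 <= dyadic c <= 1.
Proof. by have := dyadic_approx c 0; rewrite /dyadic_sum big_ord0 add0r expr0. Qed.

End binary_digits.

(** * Continuous functions of infinitely many bits *)

Section uniformly_continuous_on_bits.
Context (R : realType).
Local Open Scope ring_scope.
Implicit Types (b : nat -> bool) (Phi Psi : (nat -> bool) -> R).

Definition agree (k : nat) (b b' : nat -> bool) := forall n, (n < k)%N -> b n = b' n.

(* Uniform continuity on the Cantor space [nat -> bool]. *)
Definition bits_continuous Phi := forall e : R, 0 < e ->
  exists k, forall b b', agree k b b' -> `|Phi b - Phi b'| <= e.

Definition truncation (k : nat) b := nth false (mkseq b k).

Lemma agree_truncation k b : agree k b (truncation k b).
Proof. by move=> n nk; rewrite /truncation nth_mkseq. Qed.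

Lemma agreeS k k' b b' : (k <= k')%N -> agree k' b b' -> agree k b b'.
Proof. by move=> kk' h n nk; apply: h; exact: leq_trans nk kk'. Qed.

(** Up to an error of 1, [Phi] takes only finitely many values, one for each word of length [k]. *)
Lemma bits_continuous_bounded Phi : bits_continuous Phi ->
  exists M, forall b, `|Phi b| <= M.
Proof.
move=> /(_ 1 ltr01)[k hk].
exists (\sum_(w : k.-tuple bool) `|Phi (nth false w)| + 1) => b.
have := hk _ _ (@agree_truncation k b).
have sk : size (mkseq b k) == k by rewrite size_mkseq.
have : `|Phi (truncation k b)| <= \sum_(w : k.-tuple bool) `|Phi (nth false w)|.
  by rewrite (bigD1 (Tuple sk))//= lerDl sumr_ge0.
move=> h1 h2; rewrite -[Phi b](subrK (Phi (truncation k b))).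
by apply: (le_trans (ler_normD _ _)); lra.
Qed.

Lemma bits_continuousM Phi Psi : bits_continuous Phi -> bits_continuous Psi ->
  bits_continuous (fun b => Phi b * Psi b).
Proof.
move=> cPhi cPsi e e0.
have [M hM] := bits_continuous_bounded cPhi.
have [N hN] := bits_continuous_bounded cPsi.
have M0 : 0 <= M by exact: le_trans (hM (fun=> false)).
have N0 : 0 <= N by exact: le_trans (hN (fun=> false)).
have MN : 0 < M + N + 1 by lra.
(* This quotient [d] satisfies [e = M * d + d * N + d]; the summand 1 excludes a zero
   denominator. *)
have d0 : 0 < e / (M + N + 1) by rewrite divr_gt0.
have [k hk] := cPhi _ d0; have [k' hk'] := cPsi _ d0.
exists (maxn k k') => b b' bb'.
have := hk _ _ (agreeS (leq_maxl _ _) bb').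
have := hk' _ _ (agreeS (leq_maxr _ _) bb').
set d := e / _ => h1 h2.
have -> : Phi b * Psi b - Phi b' * Psi b' =
  Phi b * (Psi b - Psi b') + (Phi b - Phi b') * Psi b' by ring.
have -> : e = M * d + d * N + d by rewrite /d; field; rewrite gt_eqF.
apply: (le_trans (ler_normD _ _)); rewrite !normrM.
have := ler_pM (normr_ge0 _) (normr_ge0 _) (hM b) h1.
have := ler_pM (normr_ge0 _) (normr_ge0 _) h2 (hN b').
have : 0 <= d by exact: ltW.
lra.
Qed.

Lemma bits_continuous_ent Phi : (forall b, 0 <= Phi b <= 1) ->
  bits_continuous Phi -> bits_continuous (fun b => ent_term (Phi b)).
Proof.
move=> Phi01 cPhi e e0.
have d0 : 0 < (e / 2) ^+ 2 by rewrite exprn_gt0// divr_gt0.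
have [k hk] := cPhi _ d0; exists k => b b' /hk h.
apply: (le_trans (ent_term_modulus (Phi01 b) (Phi01 b'))).
have : Num.sqrt `|Phi b - Phi b'| <= e / 2.
  rewrite -[leRHS]ger0_norm; last by rewrite divr_ge0// ltW.
  by rewrite -(sqrtr_sqr (e / 2)) ler_wsqrtr.
lra.
Qed.

(** A set decided by the first [k] bits; one implication is enough, since [agree k] is symmetric. *)
Definition cylinder (k : nat) (D : set (nat -> bool)) :=
  forall b b', agree k b b' -> D b -> D b'.

Lemma bits_continuous_indic k D : cylinder k D -> bits_continuous (\1_D).
Proof.
move=> cD e e0; exists k => b b' bb'.
suff -> : \1_D b = \1_D b' :> R by rewrite subrr normr0 ltW.
rewrite !indicE; congr (_ %:R); congr (nat_of_bool _).
apply/idP/idP => /set_mem Db; apply/mem_set; apply: cD Db => //.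
by move=> n nk; rewrite bb'.
Qed.

Lemma bits_continuous_comp (f : (nat -> bool) -> nat -> bool) Phi :
  (forall k, exists k', forall b b', agree k' b b' -> agree k (f b) (f b')) ->
  bits_continuous Phi -> bits_continuous (fun b => Phi (f b)).
Proof.
move=> cf cPhi e e0; have [k hk] := cPhi _ e0; have [k' hk'] := cf k.
by exists k' => b b' bb'; apply/hk/hk'.
Qed.

Lemma bits_continuous_dyadic : bits_continuous (@dyadic R).
Proof.
move=> e e0; have [J Je] := half_expn_small e0; exists J => b b' bb'.
have sE : dyadic_sum R b J = dyadic_sum R b' J.
  by apply: eq_bigr => j _; rewrite bb'.
apply: le_trans Je.
have /andP[] := dyadic_approx R b J; have /andP[] := dyadic_approx R b' J.
by rewrite sE ler_norml => *; apply/andP; split; lra.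
Qed.

Section measurability.
Context d (T : measurableType d) (beta : T -> nat -> bool).
Hypothesis mbeta : forall n, measurable [set x | beta x n].

Definition cell k (w : seq bool) : set T := [set x | mkseq (beta x) k = w].

Lemma measurable_cell k (w : seq bool) : measurable (cell k w).
Proof.
have [<-|sw] := eqVneq (size w) k; first exact: measurable_mkseq.
rewrite (_ : cell k w = set0)//; apply/seteqP; split => // x xw.
by move: sw; rewrite -xw size_mkseq eqxx.
Qed.

Lemma truncationE k Phi x : Phi (truncation k (beta x)) =
  \sum_(w : k.-tuple bool) Phi (nth false w) * \1_(cell k w) x.
Proof.
have sk : size (mkseq (beta x) k) == k by rewrite size_mkseq.
rewrite (bigD1 (Tuple sk))//= indicE mem_set// mulr1 big1 ?addr0// => w wk.
rewrite indicE memNset ?mulr0//= => xw; move/eqP: wk; apply.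
by apply: val_inj; rewrite /= xw.
Qed.

Lemma measurable_truncation k Phi :
  measurable_fun [set: T] (fun x => Phi (truncation k (beta x))).
Proof.
under eq_fun => x do rewrite truncationE.
apply: measurable_sum => w; apply: measurable_funM => //.
by apply: measurable_indic; exact: measurable_cell.
Qed.

(** The function is a limit of its truncations, which by [truncationE] are finite combinations of
    indicators of cells. *)
Lemma measurable_bits_continuous Phi : bits_continuous Phi ->
  measurable_fun [set: T] (fun x => Phi (beta x)).
Proof.
move=> cPhi.
have e0 n : 0 < n.+1%:R^-1 :> R by rewrite invr_gt0.
pose k n := sval (cid (cPhi _ (e0 n))).
have hk n x : `|Phi (beta x) - Phi (truncation (k n) (beta x))| <= n.+1%:R^-1.
  by apply: (svalP (cid (cPhi _ (e0 n)))); exact: agree_truncation.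
apply: (@measurable_fun_cvg _ _ _ _ (fun n x => Phi (truncation (k n) (beta x)))).
  by move=> n; exact: measurable_truncation.
move=> x _; apply/cvgrPdist_le => e ep; near=> n.
apply: (le_trans (hk n x)); rewrite ltW//; near: n; exact: (near_infty_natSinv_lt (PosNum ep)).
Unshelve. all: by end_near. Qed.

End measurability.

End uniformly_continuous_on_bits.

(** * Means of bounded families *)

Section means.
Context (R : realType) (I : Type).
Local Open Scope ring_scope.
Implicit Types (f g : I -> R).

Definition family_bounded f := exists M, forall i, `|f i| <= M.

(* Covers both convex combinations and limits along ultrafilters. *)
Record is_mean (L : (I -> R) -> R) : Prop := IsMean {
  mean_linear : forall a f g, family_bounded f -> family_bounded g ->
    L (fun i => a * f i + g i) = a * L f + L g;
  mean_ge0 : forall f, family_bounded f -> (forall i, 0 <= f i) -> 0 <= L f;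
  mean1 : L (fun=> 1) = 1
}.

Lemma family_bounded_cst a : family_bounded (fun=> a).
Proof. by exists `|a|. Qed.

Lemma family_boundedD f g : family_bounded f -> family_bounded g ->
  family_bounded (fun i => f i + g i).
Proof.
move=> [M hM] [N hN]; exists (M + N) => i.
by apply: (le_trans (ler_normD _ _)); rewrite lerD.
Qed.

Lemma family_boundedZ a f : family_bounded f -> family_bounded (fun i => a * f i).
Proof. by move=> [M hM]; exists (`|a| * M) => i; rewrite normrM ler_wpM2l. Qed.

Lemma family_bounded_sum (J : Type) (s : seq J) (F : J -> I -> R) :
  (forall j, family_bounded (F j)) -> family_bounded (fun i => \sum_(j <- s) F j i).
Proof.
move=> bF; elim: s => [|j s IH].
  by rewrite (_ : (fun _ => _) = fun=> 0); [exact: family_bounded_cst|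
    apply/funext => i; rewrite big_nil].
rewrite (_ : (fun _ => _) = fun i => F j i + \sum_(j <- s) F j i).
  exact: family_boundedD.
by apply/funext => i; rewrite big_cons.
Qed.

Variables (L : (I -> R) -> R) (meanL : is_mean L).

Lemma meanD f g : family_bounded f -> family_bounded g ->
  L (fun i => f i + g i) = L f + L g.
Proof.
move=> bf bg; rewrite -[L f]mul1r -mean_linear//; congr L.
by apply/funext => i; rewrite mul1r.
Qed.

Lemma mean0 : L (fun=> 0) = 0.
Proof.
have b0 := family_bounded_cst 0; have := meanD b0 b0.
rewrite (_ : (fun=> 0 + 0) = fun=> 0) => [|]; last by apply/funext => i; rewrite addr0.
by move=> h; apply: (addrI (L (fun=> 0))); rewrite addr0 -h.
Qed.

Lemma meanZ a f : family_bounded f -> L (fun i => a * f i) = a * L f.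
Proof.
move=> bf; have := mean_linear meanL a bf (family_bounded_cst 0).
by rewrite mean0 addr0 => <-; congr L; apply/funext => i; rewrite addr0.
Qed.

Lemma mean_cst a : L (fun=> a) = a.
Proof.
have := meanZ a (family_bounded_cst 1); rewrite (mean1 meanL) mulr1 => {2}<-.
by congr (L _); apply/funext => i; rewrite mulr1.
Qed.

Lemma meanB f g : family_bounded f -> family_bounded g ->
  L (fun i => f i - g i) = L f - L g.
Proof.
move=> bf bg; rewrite -mulN1r -meanZ// -meanD//; last exact: family_boundedZ.
by congr L; apply/funext => i; rewrite mulN1r.
Qed.

Lemma le_mean f g : family_bounded f -> family_bounded g ->
  (forall i, f i <= g i) -> L f <= L g.
Proof.
move=> bf bg fg; rewrite -subr_ge0 -meanB//; apply: mean_ge0 => //.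
  rewrite (_ : (fun _ => _) = fun i => -1 * f i + g i).
    by apply: family_boundedD => //; exact: family_boundedZ.
  by apply/funext => i; rewrite mulN1r addrC.
by move=> i; rewrite subr_ge0.
Qed.

Lemma mean_sum (J : Type) (s : seq J) (F : J -> I -> R) :
  (forall j, family_bounded (F j)) ->
  L (fun i => \sum_(j <- s) F j i) = \sum_(j <- s) L (F j).
Proof.
move=> bF; elim: s => [|j s IH].
  rewrite big_nil -[RHS]mean0; congr L.
  by apply/funext => i; rewrite big_nil.
rewrite big_cons -IH -meanD//; last exact: family_bounded_sum.
by congr L; apply/funext => i; rewrite big_cons.
Qed.

(** Uniform continuity with constant 1 is the only continuity available for a general mean; all
    later approximations are therefore uniform in the index. *)
Lemma mean_dist f g e : family_bounded f -> family_bounded g ->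
  (forall i, `|f i - g i| <= e) -> `|L f - L g| <= e.
Proof.
move=> bf bg fge; rewrite ler_norml lerBrDr lerBlDr.
have be := family_bounded_cst e.
have beg := family_boundedD be bg; have bef := family_boundedD be bf.
apply/andP; split.
  rewrite addrC lerBlDr addrC -[X in X + L f](mean_cst e) -meanD//.
  apply: le_mean => // i; have := fge i; rewrite ler_norml => /andP[]; lra.
rewrite -[X in X + L g](mean_cst e) -meanD//.
apply: le_mean => // i; have := fge i; rewrite ler_norml => /andP[]; lra.
Qed.

End means.

Section expectation.
Context d (T : measurableType d) (R : realType) (Q : probability T R).
Local Open Scope ring_scope.

Lemma integrable_bounded (f : T -> R) : measurable_fun [set: T] f ->
  (exists M, forall x, `|f x| <= M) -> Q.-integrable [set: T] (EFin \o f).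
Proof.
move=> mf [M fM]; apply: measurable_bounded_integrable => //.
  exact: le_lt_trans (probability_le1 Q measurableT) (ltry 1).
exists M; split; first exact: num_real.
by move=> y My x _; apply: le_trans (fM x) (ltW My).
Qed.

Lemma Rintegral_cst1 (a : R) : \int[Q]_x a = a.
Proof. by rewrite Rintegral_cst//= probability_setT mulr1. Qed.

Lemma Rintegral_dist (f g : T -> R) e :
  measurable_fun [set: T] f -> measurable_fun [set: T] g ->
  (exists M, forall x, `|f x| <= M) -> (exists M, forall x, `|g x| <= M) ->
  (forall x, `|f x - g x| <= e) -> `|\int[Q]_x f x - \int[Q]_x g x| <= e.
Proof.
move=> mf mg [M fM] [N gN] fge.
have intf : Q.-integrable [set: T] (EFin \o f) by apply: integrable_bounded => //; exists M.
have intg : Q.-integrable [set: T] (EFin \o g) by apply: integrable_bounded => //; exists N.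
have mfg : measurable_fun [set: T] (fun x => f x - g x) by exact: measurable_funB.
rewrite -RintegralB//; apply: (le_trans (le_normr_Rintegral _ _)) => //.
  by apply: integrable_bounded => //; exists e.
rewrite -[leRHS]Rintegral_cst1; apply: le_Rintegral => //.
- apply: integrable_bounded; first exact: measurableT_comp.
  by exists e => x; rewrite normr_id.
- by apply: integrable_bounded => //; exists `|e|.
Qed.

Lemma Rintegral_bound (f : T -> R) M : measurable_fun [set: T] f ->
  (forall x, `|f x| <= M) -> `|\int[Q]_x f x| <= M.
Proof.
move=> mf fM; rewrite -[X in `|X|]subr0 -[X in _ - X](Rintegral_cst1 0).
apply: Rintegral_dist => //; [by exists M|by exists 0 => x; rewrite normr0|].
by move=> x; rewrite subr0.
Qed.

Lemma Rintegral_sum (J : Type) (s : seq J) (F : J -> T -> R) :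
  (forall j, measurable_fun [set: T] (F j)) ->
  (forall j, exists M, forall x, `|F j x| <= M) ->
  \int[Q]_x (\sum_(j <- s) F j x) = \sum_(j <- s) \int[Q]_x F j x.
Proof.
move=> mF bF; elim: s => [|j s IH].
  rewrite big_nil -[RHS]Rintegral_cst1; apply: eq_Rintegral => x _.
  by rewrite big_nil.
rewrite big_cons -IH -RintegralD//.
- by apply: eq_Rintegral => x _; rewrite big_cons.
- exact: integrable_bounded.
- apply: integrable_bounded; first exact: measurable_sum.
  exact: (@family_bounded_sum _ _ _ s F bF).
Qed.

Lemma Rintegral_indicZ (a : R) A : measurable A ->
  \int[Q]_x (a * \1_A x) = a * fine (Q A).
Proof.
move=> mA; rewrite RintegralZl//; last first.
  apply: integrable_bounded; first exact: measurable_indic.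
  by exists 1 => x; rewrite indicE; case: (_ \in _); rewrite ?normr1// normr0 ler01.
by rewrite /Rintegral integral_indic// setIT.
Qed.

End expectation.

(** * Realizing a mean of laws of bit sequences *)

Section transfer.
Context (R : realType) (I : Type) (L : (I -> R) -> R) (meanL : is_mean L).
Local Open Scope ring_scope.
Variables (dT : I -> measure_display) (T : forall i, measurableType (dT i)).
Variables (Q : forall i, probability (T i) R) (beta : forall i, T i -> nat -> bool).
Arguments beta : clear implicits.
Hypothesis mbeta : forall i n, measurable [set x | beta i x n].

Let word_prob (i : I) (w : seq bool) : R := fine (Q i (cell (beta i) (size w) w)).

Let word_prob01 i w : 0 <= word_prob i w <= 1.
Proof.
have mc : measurable (cell (beta i) (size w) w) by exact: measurable_cell.
rewrite /word_prob fine_ge0//= -lee_fin fineK ?fin_num_measure//.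
exact: probability_le1.
Qed.

Let word_prob_bounded w : family_bounded (word_prob ^~ w).
Proof.
by exists 1 => i; have /andP[h0 h1] := word_prob01 i w; rewrite ger0_norm.
Qed.

Let word_prob_rcons i w :
  word_prob i w = word_prob i (rcons w false) + word_prob i (rcons w true).
Proof.
have mc v : measurable (cell (beta i) (size v) v) by exact: measurable_cell.
rewrite /word_prob -fineD ?fin_num_measure//; congr fine.
rewrite -measureU//.
  congr (Q i _); apply/seteqP; split => x /=; rewrite /cell/= !size_rcons !mkseqS.
    by move=> ->; case: (beta i x _); [right|left].
  by move=> [] /rcons_inj [].
apply/seteqP; split => // x [] /=; rewrite /cell/= !size_rcons !mkseqS.
by move=> /rcons_inj [_ ->] /rcons_inj [].
Qed.

(** The means of the word probabilities form a consistent family. For functions of [k] bits the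
    formula is a finite sum over words; in general it follows by an approximation within [e / 2] on
    each side, uniform in the index, so [L] is never exchanged with a countable limit. *)
Lemma mean_bits_exist : exists b : R -> nat -> bool,
  (forall n, measurable [set x | b x n]) /\
  forall Phi, bits_continuous Phi ->
    \int[uniform_prob (@ltr01 R)]_x Phi (b x) =
    L (fun i => \int[Q i]_x Phi (beta i x)).
Proof.
have [||| b [mb bE]] := @random_bits_exist R (fun w => L (word_prob ^~ w)).
- by move=> w; apply: mean_ge0 => // i; case/andP: (word_prob01 i w).
- rewrite -[RHS](mean_cst meanL); congr L; apply/funext => i.
  rewrite /word_prob (_ : cell _ _ _ = setT) ?probability_setT//.
  by apply/seteqP; split => // x.
- move=> w; rewrite -meanD//; congr L; apply/funext => i; exact: word_prob_rcons.
exists b; split => // Phi cPhi.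
have [M hM] := bits_continuous_bounded cPhi.
set P := uniform_prob _.
have truncE k : \int[P]_x Phi (truncation k (b x)) =
    L (fun i => \int[Q i]_x Phi (truncation k (beta i x))).
  transitivity (\sum_(w : k.-tuple bool) Phi (nth false w) * L (word_prob ^~ w)).
    under eq_Rintegral => x _ do rewrite truncationE.
    rewrite Rintegral_sum; last 2 first.
    - by move=> w; apply: measurable_funM => //; apply: measurable_indic; exact: measurable_cell.
    - move=> w; exists `|Phi (nth false w)| => x; rewrite normrM indicE.
      by case: (_ \in _); rewrite ?normr1 ?mulr1// normr0 mulr0.
    apply: eq_bigr => w _; rewrite Rintegral_indicZ; last exact: measurable_cell.
    by congr (_ * _); rewrite -[RHS]/(fine (L (word_prob ^~ w))%:E) -(bE w) size_tuple.
  transitivity (L (fun i => \sum_(w : k.-tuple bool) Phi (nth false w) * word_prob i w)).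
    rewrite mean_sum//; last by move=> w; exact: family_boundedZ.
    by apply: eq_bigr => w _; rewrite meanZ.
  congr L; apply/funext => i.
  under eq_Rintegral => x _ do rewrite truncationE//.
  rewrite Rintegral_sum; last 2 first.
  - by move=> w; apply: measurable_funM => //; apply: measurable_indic; exact: measurable_cell.
  - move=> w; exists `|Phi (nth false w)| => x; rewrite normrM indicE.
    by case: (_ \in _); rewrite ?normr1 ?mulr1// normr0 mulr0.
  apply: eq_bigr => w _; rewrite Rintegral_indicZ; last exact: measurable_cell.
  by rewrite /word_prob size_tuple.
have bRint i k : `|\int[Q i]_x Phi (truncation k (beta i x))| <= M.
  by apply: Rintegral_bound => //; exact: measurable_truncation.
have bRint' i : `|\int[Q i]_x Phi (beta i x)| <= M.
  by apply: Rintegral_bound => //; exact: measurable_bits_continuous.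
apply/eqP; rewrite -subr_eq0 -normr_le0; apply/ler_addgt0Pr => e e0.
have e2 : 0 < e / 2 by rewrite divr_gt0.
have [k hk] := cPhi _ e2; rewrite add0r.
have h1 : `|\int[P]_x Phi (b x) - \int[P]_x Phi (truncation k (b x))| <= e / 2.
  apply: Rintegral_dist; [exact: measurable_bits_continuous|exact: measurable_truncation| | |].
  - by exists M.
  - by exists M.
  - by move=> x; apply: hk; exact: agree_truncation.
have h2 : `|L (fun i => \int[Q i]_x Phi (truncation k (beta i x))) -
    L (fun i => \int[Q i]_x Phi (beta i x))| <= e / 2.
  apply: mean_dist => //; [by exists M|by exists M|move=> i].
  apply: Rintegral_dist; [exact: measurable_truncation|exact: measurable_bits_continuous| | |].
  - by exists M.
  - by exists M.
  - by move=> x; rewrite distrC; apply: hk; exact: agree_truncation.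
rewrite -truncE in h2.
apply: le_trans (ler_distD (\int[P]_x Phi (truncation k (b x))) _ _) _.
by rewrite [leRHS](splitr e) lerD.
Qed.

End transfer.

(** * Means of joint variables *)

Section mean_of_sums.
Context (R : realType) (I : Type) (L : (I -> R) -> R) (meanL : is_mean L).
Context (E : pointedType) (a : I -> E -> R) (s : E -> R).
Hypothesis a_ge0 : forall i k, (0 <= a i k)%R.
Hypothesis a_le : forall i k, (a i k <= s k)%R.
Hypothesis s_fin : \esum_(k in [set: E]) (s k)%:E < +oo.

(** An analogue of Fatou's inequality: finite partial sums pass through [L], and each is at most the
    mean of the whole sums. *)
Let mean_esum_le (b : I -> E -> R) :
  (forall i k, (0 <= b i k <= s k)%R) ->
  \esum_(k in [set: E]) (L (b ^~ k))%:E <=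
  (L (fun i => fine (\esum_(k in [set: E]) (b i k)%:E)))%:E.
Proof.
move=> b01.
have bb k : family_bounded (b ^~ k).
  by exists (s k) => i; case/andP: (b01 i k) => b0 b1; rewrite ger0_norm.
have bfin i : \esum_(k in [set: E]) (b i k)%:E \is a fin_num.
  rewrite ge0_fin_numE; last by apply: esum_ge0 => k _; rewrite lee_fin; case/andP: (b01 i k).
  apply: le_lt_trans s_fin; apply: le_esum => k _; rewrite lee_fin.
  by case/andP: (b01 i k).
apply: ge_ereal_sup => _ [F [finF _] <-].
rewrite fsbig_finite//= sumEFin lee_fin -mean_sum//.
apply: le_mean => //.
- exact: family_bounded_sum.
- exists (fine (\esum_(k in [set: E]) (s k)%:E)) => i.
  have e0 : 0 <= \esum_(k in [set: E]) (b i k)%:E.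
    by apply: esum_ge0 => k _; rewrite lee_fin; case/andP: (b01 i k).
  rewrite ger0_norm ?fine_ge0// fine_le//.
    rewrite ge0_fin_numE//; apply: esum_ge0 => k _; rewrite lee_fin.
    by case/andP: (b01 i k) => /le_trans h/h.
  by apply: le_esum => k _; rewrite lee_fin; case/andP: (b01 i k).
- move=> i; rewrite -lee_fin fineK// -sumEFin; apply: esum_ge; exists F => //.
  by rewrite fsbig_finite.
Qed.

(** Dominated convergence for [L]: [mean_esum_le] is applied to [a] and to [s - a]. The two totals
    add up to the finite sum of [s] on either side, which forces equality. *)
Lemma mean_esum :
  fine (\esum_(k in [set: E]) (L (a ^~ k))%:E) =
  L (fun i => fine (\esum_(k in [set: E]) (a i k)%:E)).
Proof.
have s0 (i : I) k : (0 <= s k)%R by exact: le_trans (a_ge0 i k) (a_le i k).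
have a01 i k : (0 <= a i k <= s k)%R by rewrite a_ge0 a_le.
have c01 i k : (0 <= s k - a i k <= s k)%R by rewrite subr_ge0 a_le lerBlDr lerDl a_ge0.
have ab k : family_bounded (a ^~ k).
  by exists (s k) => i; rewrite ger0_norm.
have Lge0 k : 0 <= (L (a ^~ k))%:E by rewrite lee_fin; apply: mean_ge0.
have Lc k : L (fun i => s k - a i k)%R = (s k - L (a ^~ k))%R.
  by rewrite meanB ?mean_cst//; exact: family_bounded_cst.
have Lcge0 k : 0 <= (s k - L (a ^~ k))%:E.
  rewrite lee_fin -Lc; apply: mean_ge0 => // [|i]; last by case/andP: (c01 i k).
  by exists (s k) => i; case/andP: (c01 i k) => c0 c1; rewrite ger0_norm.
have := mean_esum_le a01; have := mean_esum_le c01.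
have sfin := s_fin; set S := \esum_(k in _) (s k)%:E in sfin *.
have SE : S = \esum_(k in [set: E]) (s k - L (a ^~ k))%:E +
              \esum_(k in [set: E]) (L (a ^~ k))%:E.
  by rewrite -esumD//; apply: eq_esum => k _; rewrite -EFinD subrK.
set S1 := \esum_(k in _) (L (a ^~ k))%:E in SE *.
set S2 := \esum_(k in _) (s k - L (a ^~ k))%:E in SE *.
have S10 : 0 <= S1 by exact: esum_ge0.
have S20 : 0 <= S2 by exact: esum_ge0.
have S1fin : S1 \is a fin_num.
  by rewrite ge0_fin_numE//; apply: le_lt_trans sfin; rewrite SE leeDr.
have S2fin : S2 \is a fin_num.
  by rewrite ge0_fin_numE//; apply: le_lt_trans sfin; rewrite SE leeDl.
have -> : \esum_(k in [set: E]) (L (fun i => s k - a i k)%R)%:E = S2.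
  by apply: eq_esum => k _; rewrite Lc.
have Sfin : S \is a fin_num by rewrite SE fin_numD S2fin S1fin.
have SiE i : fine (\esum_(k in [set: E]) (s k - a i k)%:E) =
    (fine S - fine (\esum_(k in [set: E]) (a i k)%:E))%R.
  have SEi : S = \esum_(k in [set: E]) (s k - a i k)%:E +
                 \esum_(k in [set: E]) (a i k)%:E.
    rewrite -esumD.
    - by apply: eq_esum => k _; rewrite -EFinD subrK.
    - by move=> k _; rewrite lee_fin; case/andP: (c01 i k).
    - by move=> k _; rewrite lee_fin.
  have : S \is a fin_num by [].
  rewrite [in X in X -> _]SEi fin_numD => /andP[f1 f2].
  by rewrite [in RHS]SEi fineD// addrK.
under [X in _ <= (L X)%:E -> _]eq_fun => i do rewrite SiE.
have Sab : family_bounded (fun i => fine (\esum_(k in [set: E]) (a i k)%:E)).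
  exists (fine S) => i.
  have e0 : 0 <= \esum_(k in [set: E]) (a i k)%:E by apply: esum_ge0 => k _; rewrite lee_fin.
  have le_S : \esum_(k in [set: E]) (a i k)%:E <= S.
    by apply: le_esum => k _; rewrite lee_fin.
  rewrite ger0_norm ?fine_ge0// fine_le//.
  by rewrite ge0_fin_numE//; exact: le_lt_trans sfin.
rewrite meanB//; last exact: family_bounded_cst.
rewrite mean_cst// -(fineK S1fin) -(fineK S2fin) !lee_fin SE fineD// => h1 h2.
by apply/eqP; rewrite eq_le; apply/andP; split; lra.
Qed.

End mean_of_sums.

(** * The sigma-algebra of bit sequences *)

Definition cylinders : set (set (nat -> bool)) := [set D | exists k, cylinder k D].

Local Notation bit_sequence := (g_sigma_algebraType cylinders).

Lemma measurable_cylinder k D : cylinder k D -> measurable (D : set bit_sequence).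
Proof. by move=> cD; apply: sub_sigma_algebra; exists k. Qed.

Lemma cylinder_measurable_preimage d (T : measurableType d)
    (beta : T -> nat -> bool) k D :
  (forall n, measurable [set x | beta x n]) -> cylinder k D ->
  measurable (beta @^-1` D).
Proof.
move=> mb cD.
rewrite (_ : _ @^-1` _ = \bigcup_(w : seq bool)
    (if nth false w \in D then cell beta k w else set0)).
  apply: countable_bigcupT_measurable; first exact: countableP.
  by move=> w; case: ifP => // _; exact: measurable_cell.
apply/seteqP; split => [x Dx|x [w _]].
  exists (mkseq (beta x) k) => //; rewrite ifT//; apply/mem_set.
  by apply: cD Dx; exact: (@agree_truncation k).
case: ifPn => // /set_mem Dw xw; apply: cD Dw => n nk.
by rewrite -xw nth_mkseq.
Qed.

Lemma measurable_to_bit_sequence d (T : measurableType d) (beta : T -> bit_sequence) :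
  (forall n, measurable [set x | beta x n]) -> measurable_fun [set: T] beta.
Proof.
move=> mb; have h := @measurability _ _ T bit_sequence setT beta cylinders.
apply: h => //.
by move=> _ [D [k cD] <-]; rewrite setTI; apply: cylinder_measurable_preimage mb cD.
Qed.

Lemma measurable_bit n : measurable [set u : bit_sequence | u n].
Proof.
by apply: (@measurable_cylinder n.+1) => b b' bb'; rewrite /mkset (bb' n).
Qed.

Lemma cylinder_setI_closed :
  setI_closed cylinders.
Proof.
move=> C D [k cC] [k' cD]; exists (maxn k k') => b b' bb' [Cb Db]; split.
  by apply: cC Cb; exact: agreeS (leq_maxl _ _) bb'.
by apply: cD Db; exact: agreeS (leq_maxr _ _) bb'.
Qed.

Section version_on_cylinders.
Context d (W : measurableType d) (R : realType) (P : probability W R).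
Variable (U : {RV P >-> bit_sequence}).

(** Cylinders are stable under intersection and generate the sigma-algebra, so Dynkin's induction
    applies. This reduction matters because a mean gives access to cylinders only. *)
Lemma is_version_cylinder (M : set W) (q : bit_sequence -> R) : measurable M ->
  measurable_fun [set: bit_sequence] q -> (forall t, (0 <= q t <= 1)%R) ->
  (forall k D, cylinder k D ->
    \int[distribution P U]_(t in D) (q t)%:E = P (M `&` U @^-1` D)) ->
  is_version U M q.
Proof.
move=> mM mq q01 qE; split => // D mD.
have q0 t : 0 <= (q t)%:E by rewrite lee_fin; case/andP: (q01 t).
have mqE (C : set bit_sequence) : measurable_fun C (EFin \o q).
  by apply: measurable_funTS; exact/measurable_EFinP.
have mMU C : measurable C -> measurable (M `&` U @^-1` C).
  by move=> mC; apply: measurableI => //; exact: measurable_preim.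
have allT : \int[distribution P U]_t (q t)%:E = P (M `&` U @^-1` setT).
  by apply: (qE 0%N).
have h := @dynkin_induction _ bit_sequence cylinders
  (fun D => \int[distribution P U]_(t in D) (q t)%:E = P (M `&` U @^-1` D)).
apply: h mD => //.
- exact: cylinder_setI_closed.
- by move=> C [k cC]; exact: (qE k).
- move=> C mC CE.
  have /eqP : \int[distribution P U]_(t in C) (q t)%:E +
      \int[distribution P U]_(t in ~` C) (q t)%:E =
      P (M `&` U @^-1` C) + P (M `&` U @^-1` (~` C)).
    have mCc : measurable (~` C) by exact: measurableC.
    rewrite -(ge0_integral_setU _ mC mCc); [|exact: mqE|
      by move=> t _; exact: q0|exact/disj_setPCl].
    rewrite setUv allT -(measureU P (mMU _ mC) (mMU _ mCc)).
      by rewrite -setIUr -preimage_setU setUv.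
    by apply/seteqP; split => // w [[_ Cw] [_ /(_ Cw)]].
  have PCfin : P (M `&` U @^-1` C) \is a fin_num by apply: fin_num_measure; exact: mMU.
  rewrite CE => /eqP /(congr1 (fun x => x - P (M `&` U @^-1` C))).
  by rewrite !(addeC (P (M `&` U @^-1` C))) !addeK.
- move=> F mF tF FE; rewrite ge0_integral_bigcup// preimage_bigcup setI_bigcupr.
  rewrite measure_bigcup//.
  + rewrite [RHS](@eq_eseriesl _ _ xpredT); last by move=> n; rewrite in_setT.
    by apply: eq_eseriesr => n _; exact: FE.
  + by move=> n _; exact: mMU.
  + apply/trivIsetP => /= i j _ _ ij; rewrite setIACA setIid -preimage_setI.
    by move/trivIsetP : tF => /(_ _ _ _ _ ij) ->//; rewrite preimage_set0 setI0.
Qed.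

End version_on_cylinders.

Lemma distribution_fibers (R : realType) dC (C : discreteMeasurableType dC)
    d (W : measurableType d) (P : probability W R) (Z : {RV P >-> C}) (S : set C) :
  distribution P Z S =
  \esum_(z in [set: C]) (if z \in S then P (Z @^-1` [set z]) else 0).
Proof.
rewrite /distribution /pushforward (measure_fibers Z); last first.
  by apply: measurable_preim; exact: discrete_measurable.
apply: eq_esum => z _; case: ifPn => zS.
  congr (P _); apply/seteqP; split => [w []//|w /= Zw].
  by split => //=; rewrite Zw; exact/set_mem.
rewrite [X in P X](_ : _ = set0) ?measure0//.
by apply/seteqP; split => // w /= [-> Sz]; move/negP: zS; apply; exact/mem_set.
Qed.

Lemma eq_distribution_points (R : realType) dC (C : discreteMeasurableType dC)
    d (W : measurableType d) (P : probability W R) (Z : {RV P >-> C})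
    d' (W' : measurableType d') (P' : probability W' R) (Z' : {RV P' >-> C})
    (S : set C) :
  (forall z, P (Z @^-1` [set z]) = P' (Z' @^-1` [set z])) ->
  distribution P Z S = distribution P' Z' S.
Proof.
by move=> ZZ'; rewrite !distribution_fibers; apply: eq_esum => z _; rewrite ZZ'.
Qed.

Section real_integrals.
Context d (T : measurableType d) (R : realType) (Q : probability T R).

Lemma integral_Rintegral (g : T -> R) : measurable_fun [set: T] g ->
  (forall x, (0 <= g x <= 1)%R) ->
  \int[Q]_x (g x)%:E = (\int[Q]_x g x)%R%:E.
Proof.
move=> mg g01; rewrite /Rintegral fineK//; apply: integrable_fin_num => //.
apply: integrable_bounded => //; exists 1%R => x.
by case/andP: (g01 x) => g0 g1; rewrite ger0_norm.
Qed.

Lemma integral_Rintegral_indic (g : T -> R) N : measurable_fun [set: T] g ->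
  (forall x, (0 <= g x <= 1)%R) -> measurable N ->
  \int[Q]_(x in N) (g x)%:E = (\int[Q]_x (g x * \1_N x))%R%:E.
Proof.
move=> mg g01 mN; rewrite -integral_Rintegral; last 2 first.
- by apply: measurable_funM => //; exact: measurable_indic.
- move=> x; case/andP: (g01 x) => g0 g1; rewrite indicE.
  by case: (_ \in _); rewrite ?mulr1 ?mulr0 ?g0 ?g1 ?lexx ?ler01.
rewrite integral_mkcond; apply: eq_integral => x _; rewrite patchE indicE.
by case: ifPn => _; rewrite ?mulr1 ?mulr0.
Qed.

End real_integrals.

Lemma integral_law_ent d (W : measurableType d) (R : realType) (P : probability W R)
    dT (T : measurableType dT) (U : {RV P >-> T}) (q : T -> R) :
  measurable_fun [set: T] q -> (forall t, (0 <= q t <= 1)%R) ->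
  \int[distribution P U]_t (ent_term (q t))%:E =
  (\int[P]_w ent_term (q (U w)))%R%:E.
Proof.
move=> mq q01; rewrite integral_law//; last 2 first.
- exact: measurable_ent_comp.
- by move=> t _; rewrite lee_fin ent_term_ge0.
rewrite preimage_setT integral_Rintegral//.
- apply: measurableT_comp; first exact: measurable_ent_term.
  exact: measurableT_comp.
- by move=> w; rewrite ent_term_ge0//= ent_term_le1.
Qed.

(** * The mean of a family of joint variables *)

Section realization.
Local Unset Implicit Arguments.
Context (R : realType) d (W : measurableType d) (P : probability W R).
Context dA dB (A : discreteMeasurableType dA) (B : discreteMeasurableType dB).
Variables (X : {RV P >-> A}) (Y : {RV P >-> B}).
Context (I : Type) (L : (I -> R) -> R) (meanL : is_mean L).
Variable (V : I -> joint_rv X Y).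

Local Notation C := (A * B)%type.
Let Z i : {RV jP (V i) >-> C} := pairRV (jX (V i)) (jY (V i)).

Let codeA : A -> nat := sval (cid (elimT (countable_injP _) (@discrete_countable _ A))).
Let codeB : B -> nat := sval (cid (elimT (countable_injP _) (@discrete_countable _ B))).

Let codeA_inj : injective codeA.
Proof.
move=> x x'; have h := svalP (cid (elimT (countable_injP _) (@discrete_countable _ A))).
by apply: h; rewrite inE.
Qed.

Let codeB_inj : injective codeB.
Proof.
move=> y y'; have h := svalP (cid (elimT (countable_injP _) (@discrete_countable _ B))).
by apply: h; rewrite inE.
Qed.

(** The tags 0, 1 and 2 keep points, rows and columns apart; a number that codes none of them yields
    the empty event. *)
Let idZ (z : C) : nat := pickle (0, pickle (codeA z.1, codeB z.2))%N.
Let idX (x : A) : nat := pickle (1, codeA x)%N.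
Let idY (y : B) : nat := pickle (2, codeB y)%N.

(* A sequence of events listing the singletons, the rows and the columns. *)
Let event (l : nat) : set C := [set z | [\/ l = idZ z, l = idX z.1 | l = idY z.2]].

Let eventZ z : event (idZ z) = [set z].
Proof.
apply/seteqP; split => [z'|_ ->]; last by constructor 1.
case; last 2 first.
- by move=> /(pcan_inj pickleK)[].
- by move=> /(pcan_inj pickleK)[].
move=> /(pcan_inj pickleK)[] /(pcan_inj pickleK)[] /codeA_inj + /codeB_inj.
by case: z z' => [x y] [x' y'] /= -> ->.
Qed.

Let eventX x : event (idX x) = fst @^-1` [set x].
Proof.
apply/seteqP; split => [z'|z' /= <-]; last by constructor 2.
by case => /(pcan_inj pickleK)[] // /codeA_inj ->.
Qed.

Let eventY y : event (idY y) = snd @^-1` [set y].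
Proof.
apply/seteqP; split => [z'|z' /= <-]; last by constructor 3.
by case => /(pcan_inj pickleK)[] // /codeB_inj ->.
Qed.

Let mevent i l : measurable (Z i @^-1` event l).
Proof. by apply: measurable_preim; exact: discrete_measurable. Qed.

Let q i l : jalphabet (V i) -> R := sval (cid (version_exists (jU (V i)) (mevent i l))).

Let qv i l : is_version (jU (V i)) (Z i @^-1` event l) (q i l).
Proof. exact: (svalP (cid (version_exists (jU (V i)) (mevent i l)))). Qed.

(* Bits numbered [pickle (l, 0)] tell whether the l-th event holds; the bits
   numbered [pickle (l, j.+1)] are the binary digits of its conditional
   probability. The latter are the only ones kept by [mask]. *)
Let mask (b : nat -> bool) : nat -> bool :=
  fun n => if unpickle n : option (nat * nat) is Some (_, _.+1) then b n else false.

(** A function on the alphabet of the i-th variable: through [mask_beta], a condition on the masked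
    bits becomes an event about [jU (V i)], to which [qv] applies. *)
Let ubits i (t : jalphabet (V i)) : nat -> bool := fun n =>
  if unpickle n : option (nat * nat) is Some (l, j.+1) then digit (q i l t) j else false.

Let beta i (w : jspace (V i)) : nat -> bool := fun n =>
  if unpickle n : option (nat * nat) is Some (l, j) then
    if j is j'.+1 then digit (q i l (jU (V i) w)) j' else `[< event l (Z i w) >]
  else false.

Let value (l : nat) (b : nat -> bool) : R := dyadic R (fun j => b (pickle (l, j.+1))).

Let beta0 i l w : beta i w (pickle (l, 0)%N) = `[< event l (Z i w) >].
Proof. by rewrite /beta pickleK. Qed.

Let value_beta i l w : value l (beta i w) = q i l (jU (V i) w).
Proof.
rewrite -[RHS]dyadic_digit; last by case: (qv i l).
by rewrite /value; congr dyadic; apply/funext => j; rewrite /beta pickleK.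
Qed.

Let value_mask l b : value l (mask b) = value l b.
Proof. by rewrite /value; congr dyadic; apply/funext => j; rewrite /mask pickleK. Qed.

Let mask_beta i w : mask (beta i w) = ubits i (jU (V i) w).
Proof.
apply/funext => n; rewrite /mask /beta /ubits.
by case: (unpickle n) => // -[l [|j]].
Qed.

Let mdigit i l j : measurable [set t | digit (q i l t) j].
Proof.
have mr : measurable_fun setT (fun t => remainder (q i l t) j).
  elim: j => [|j IH] /=; first by case: (qv i l).
  apply: measurable_funB; first exact: measurable_funM.
  rewrite (_ : (fun _ => _) = \1_[set t | (2^-1 <= remainder (q i l t) j)%R]); last first.
    apply/funext => t; rewrite indicE; congr (nat_of_bool _)%:R.
    by apply/idP/idP => [h|/set_mem//]; exact/mem_set.
  apply: measurable_indic; rewrite -[X in measurable X]setTI.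
  exact: measurable_fun_le.
rewrite -[X in measurable X]setTI /digit.
exact: measurable_fun_le.
Qed.

Let mbeta i n : measurable [set w | beta i w n].
Proof.
rewrite /beta; case: (unpickle n) => [[l [|j]]|].
- rewrite (_ : mkset _ = Z i @^-1` event l)//.
  by apply/seteqP; split => w /= => [/asboolP|] // ?; exact/asboolP.
- exact: (measurable_preim (jU (V i)) (mdigit i l j)).
- by rewrite (_ : mkset _ = set0)//; apply/seteqP; split.
Qed.

Let mubits i n : measurable [set t | ubits i t n].
Proof.
rewrite /ubits; case: (unpickle n) => [[l [|j]]|]; last 2 first.
- exact: mdigit.
- by rewrite (_ : mkset _ = set0)//; apply/seteqP; split.
- by rewrite (_ : mkset _ = set0)//; apply/seteqP; split.
Qed.

Let value_continuous l : bits_continuous (value l).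
Proof.
apply: (@bits_continuous_comp _ (fun b j => b (pickle (l, j.+1)))); last first.
  exact: bits_continuous_dyadic.
move=> k; exists (\max_(j < k) (pickle (l, j.+1)).+1)%N => b b' bb' j jk.
by apply: bb'; apply: (@leq_bigmax _ (fun j : 'I_k => (pickle (l, j.+1)).+1) (Ordinal jk)).
Qed.

Let agree_mask k b b' : agree k b b' -> agree k (mask b) (mask b').
Proof.
move=> bb' n nk; rewrite /mask; case: (unpickle n) => // -[l [|j]]//.
exact: bb'.
Qed.

Let value01 l b : (0 <= value l b <= 1)%R.
Proof. exact: dyadic01. Qed.

Let bits_ex := mean_bits_exist meanL (fun i => jP (V i)) mbeta.
Let b : R -> nat -> bool := sval (cid bits_ex).
Let mb n : measurable [set x | b x n].
Proof. by case: (svalP (cid bits_ex)) => + _; exact. Qed.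

Local Notation Pinf := (uniform_prob (@ltr01 R)).
Local Notation Omega := (measurableTypeR R).

Let transfer Phi : bits_continuous Phi ->
  (\int[Pinf]_x Phi (b x) = L (fun i => \int[jP (V i)]_w Phi (beta i w)))%R.
Proof. by case: (svalP (cid bits_ex)) => _; exact. Qed.

Let transfer_cylinder k D : cylinder k D ->
  Pinf [set x | D (b x)] = (L (fun i => fine (jP (V i) [set w | D (beta i w)])))%:E.
Proof.
move=> cD.
have mD1 : measurable [set x : Omega | D (b x)].
  exact: (cylinder_measurable_preimage mb cD).
have mD2 i : measurable [set w | D (beta i w)].
  exact: (cylinder_measurable_preimage (mbeta i) cD).
have := transfer _ (bits_continuous_indic cD).
have -> : (\int[Pinf]_x \1_D (b x))%R = fine (Pinf [set x | D (b x)]).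
  transitivity (\int[Pinf]_x (1 * \1_[set x | D (b x)] x))%R.
    by apply: eq_Rintegral => x _; rewrite mul1r.
  by rewrite Rintegral_indicZ// mul1r.
have -> : (fun i => \int[jP (V i)]_w \1_D (beta i w))%R =
    (fun i => fine (jP (V i) [set w | D (beta i w)])).
  apply/funext => i.
  transitivity (\int[jP (V i)]_w (1 * \1_[set w | D (beta i w)] w))%R.
    by apply: eq_Rintegral => x _; rewrite mul1r.
  by rewrite Rintegral_indicZ// mul1r.
by move=> <-; rewrite fineK// fin_num_measure.
Qed.

(** The event bits are exactly those of the outcome [z]. This countable intersection of conditions
    on single bits need not be a cylinder, so [transfer_cylinder] does not reach it directly. *)
Let good z := [set x : Omega | forall l, b x (pickle (l, 0)%N) = `[< event l z >]].

Let mbool n c : measurable [set x : Omega | b x n = c].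
Proof.
case: c; first exact: mb.
rewrite (_ : mkset _ = ~` [set x | b x n]); first by apply: measurableC; exact: mb.
by apply/seteqP; split => x /=; case: (b x n).
Qed.

Let mgood z : measurable (good z).
Proof.
rewrite (_ : good z = \bigcap_l [set x : Omega | b x (pickle (l, 0)%N) = `[< event l z >]]).
  by apply: bigcap_measurable => // l _; exact: mbool.
by apply/seteqP; split => x h l => [_|]; apply: h.
Qed.

Let lawE i z : jP (V i) (Z i @^-1` [set z]) = P (pairRV X Y @^-1` [set z]).
Proof. by have := @jlaw _ _ _ _ _ _ _ _ _ _ (V i) [set z] (discrete_measurable1 z). Qed.

(** The bit of the event {z} alone already has the right probability, all pairs having the same law.
    That this bit is set while another event bit contradicts [z] is impossible for every [i], hence
    null in the mean; sigma-additivity of the realized measure removes these countably many null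
    sets. *)
Let Pgood z : Pinf (good z) = P (pairRV X Y @^-1` [set z]).
Proof.
have mpair : measurable (pairRV X Y @^-1` [set z]) by exact: measurable_fiber.
pose c := [set x : Omega | b x (pickle (idZ z, 0)%N)].
pose bad l := [set x : Omega | b x (pickle (idZ z, 0)%N) &&
  (b x (pickle (l, 0)%N) != `[< event l z >])].
have mc : measurable c by exact: mb.
have Pc : Pinf c = P (pairRV X Y @^-1` [set z]).
  rewrite /c (@transfer_cylinder (pickle (idZ z, 0)%N).+1
    [set b | b (pickle (idZ z, 0)%N)]); last first.
    by move=> b1 b2 bb /=; rewrite bb.
  rewrite -[RHS]fineK ?fin_num_measure//; congr EFin.
  rewrite -[RHS](mean_cst meanL); congr (L _); apply/funext => i.
  rewrite -(lawE i); congr fine; congr (jP (V i) _).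
  apply/seteqP; split => w /=; rewrite beta0 eventZ.
    by move=> /asboolP.
  by move=> wz; apply/asboolP.
have mbad l : measurable (bad l).
  rewrite (_ : bad l = c `&` ~` [set x | b x (pickle (l, 0)%N) = `[< event l z >]]).
    by apply: measurableI => //; apply: measurableC; exact: mbool.
  apply/seteqP; split => x /= => [/andP[h1 /eqP h2]|[h1 h2]]//.
  by apply/andP; split => //; apply/eqP.
have Pbad l : Pinf (bad l) = 0.
  rewrite /bad (@transfer_cylinder (pickle (idZ z, 0) + pickle (l, 0)).+1%N
    [set b | b (pickle (idZ z, 0)%N) && (b (pickle (l, 0)%N) != `[< event l z >])]); last first.
    by move=> b1 b2 bb /=; rewrite !bb// ltnS (leq_addl,leq_addr).
  congr EFin; rewrite -[RHS](mean_cst meanL); congr (L _); apply/funext => i.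
  rewrite (_ : mkset _ = set0) ?measure0//; apply/seteqP; split => // w /=.
  rewrite !beta0 eventZ => /andP[/asboolP <-].
  by rewrite eqxx.
have cgood : c = good z `|` \bigcup_l bad l.
  apply/seteqP; split => x /=.
    move=> cx; have [?|/existsNP[l xl]] := pselect (good z x); [by left|right].
    by exists l => //=; apply/andP; split => //; apply/eqP.
  move=> [/(_ (idZ z))|[l _ /andP[]]//].
  rewrite eventZ /c /mkset => ->; exact/asboolP.
apply/eqP; rewrite -Pc eq_le; apply/andP; split.
  by apply: le_measure; rewrite ?inE// cgood; exact: subsetUl.
rewrite cgood; apply: (le_trans (measureU2 _ _ _)) => //.
  exact: bigcupT_measurable.
rewrite [X in _ + X](_ : _ = 0) ?adde0//; apply/eqP.
rewrite eq_le measure_ge0 andbT.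
apply: (le_trans (measure_sigma_subadditive _ mbad _ _)) => //.
  exact: bigcupT_measurable.
by rewrite eseries0// => l _ _; exact: Pbad.
Qed.

Let good_unique z z' x : good z x -> good z' x -> z = z'.
Proof.
move=> /(_ (idZ z)) gz /(_ (idZ z)); rewrite gz eventZ => zz'.
by have : `[< [set z] z >] by [exact/asboolP]; rewrite zz' => /asboolP ->.
Qed.

(** The default value [point] is used only off all the sets [good z], on a null set by
    [goods_full]. *)
Let Zinf_fun (x : Omega) : C := xget point [set z | good z x].

Let Zinf_good z x : good z x -> Zinf_fun x = z.
Proof.
move=> gz; apply: xget_unique => // z' gz'.
exact: good_unique _ _ _ gz' gz.
Qed.

Let mgoods (D : set C) : measurable (\bigcup_(z in D) good z).
Proof.
rewrite bigcup_mkcond; apply: countable_bigcupT_measurable => [|z].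
  exact: discrete_countable.
by case: ifP.
Qed.

Let mZinf : measurable_fun [set: Omega] Zinf_fun.
Proof.
move=> _ D mD; rewrite setTI.
rewrite (_ : _ @^-1` _ = \bigcup_(z in D) good z `|`
    (if point \in D then ~` (\bigcup_z good z) else set0)).
  apply: measurableU => //; case: ifP => // _; exact: measurableC.
apply/seteqP; split => [x Dx|x].
  have [[z gz]|ngood] := pselect (exists z, good z x).
    by left; exists z => //; rewrite -(Zinf_good _ _ gz).
  right; rewrite ifT; last first.
    apply/mem_set; move: Dx; rewrite /= /Zinf_fun xgetPN// => z gz.
    by apply: ngood; exists z.
  by move=> [z _ gz]; apply: ngood; exists z.
case=> [[z Dz gz]|]; first by rewrite /= (Zinf_good _ _ gz).
case: ifPn => // /set_mem Dp ngood; rewrite /= /Zinf_fun xgetPN// => z gz.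
by apply: ngood; exists z.
Qed.

HB.instance Definition _ := isMeasurableFun.Build _ _ _ _ Zinf_fun mZinf.

Let Zinf : {RV Pinf >-> C} := Zinf_fun.

(** By [Pgood] the probabilities of the sets [good z] are those of the points under the law of (X,
    Y), and these sum to 1: no mass is lost in the mean. *)
Let goods_full : Pinf (~` (\bigcup_z good z)) = 0.
Proof.
rewrite probability_setC//= (measure_fibers Zinf)//.
rewrite (_ : \esum_(z in _) _ = 1) ?subee//.
rewrite -(@probability_setT _ _ _ P) (measure_fibers (pairRV X Y))//.
apply: eq_esum => z _; rewrite setIT -Pgood; congr (Pinf _).
apply/seteqP; split => [x [zx [z' _ gz']]|x gz].
  by move: zx; rewrite /= (Zinf_good _ _ gz') => <-.
by split; [exact: Zinf_good|exists z].
Qed.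

Let Pinf_good (M N : set Omega) : measurable M -> measurable N ->
  (forall z x, good z x -> M x <-> N x) -> Pinf M = Pinf N.
Proof.
have h M' N' : measurable M' -> measurable N' ->
    (forall z x, good z x -> M' x <-> N' x) -> Pinf M' <= Pinf N'.
  move=> mM mN MN.
  have mg : measurable (~` (\bigcup_z good z)) by exact: measurableC.
  apply: (@le_trans _ _ (Pinf (N' `|` ~` (\bigcup_z good z)))).
    apply: le_measure; rewrite ?inE//; first exact: measurableU.
    move=> x Mx; have [[z _ gz]|?] := pselect ((\bigcup_z good z) x); [left|by right].
    exact/(MN z).
  apply: (le_trans (measureU2 _ _ _)) => //.
  by rewrite [X in _ + X](_ : _ = 0) ?adde0//; exact: goods_full.
move=> mM mN MN; apply/eqP; rewrite eq_le !h// => z x gz.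
by split => /MN; apply.
Qed.

Let PZinf z : Pinf (Zinf @^-1` [set z]) = P (pairRV X Y @^-1` [set z]).
Proof.
rewrite -Pgood; apply: Pinf_good => //; first exact: measurable_fiber.
move=> z' x gz' /=; rewrite (Zinf_good _ _ gz'); split => [<-//|gz].
exact: good_unique _ _ _ gz' gz.
Qed.

Let Uinf_fun (x : Omega) : bit_sequence := mask (b x).

Let mUinf : measurable_fun [set: Omega] Uinf_fun.
Proof.
apply: measurable_to_bit_sequence => n; rewrite /Uinf_fun /mask.
case: (unpickle n) => [[l [|j]]|]; last 2 first.
- exact: mb.
- by rewrite (_ : mkset _ = set0)//; apply/seteqP; split.
- by rewrite (_ : mkset _ = set0)//; apply/seteqP; split.
Qed.

HB.instance Definition _ := isMeasurableFun.Build _ _ _ _ Uinf_fun mUinf.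

Let Uinf : {RV Pinf >-> bit_sequence} := Uinf_fun.

Let mvalue l : measurable_fun [set: bit_sequence] (value l : bit_sequence -> R).
Proof.
exact: (@measurable_bits_continuous _ _ bit_sequence id measurable_bit _
  (value_continuous l)).
Qed.

Let mvalue_b l : measurable_fun [set: Omega] (fun x => value l (b x)).
Proof. exact: (measurable_bits_continuous mb (value_continuous l)). Qed.

(** On a cylinder [D], the integral of [value l] and the probability of the event are both means of
    their analogues for the index [i]. These agree because [q i l] is a version given the i-th
    variable, tested on the preimage of [D] under [ubits i]. *)
Let version_inf l : is_version Uinf (Zinf @^-1` event l) (value l).
Proof.
have mZ : measurable (Zinf @^-1` event l).
  by apply: measurable_preim; exact: discrete_measurable.
apply: is_version_cylinder => //.
move=> k D cD.
have cmD : cylinder k (mask @^-1` D).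
  by move=> b1 b2 /agree_mask bb; exact: cD.
(* The event on [Zinf] depends on all the event bits; up to a null set it is read off from the
   single bit numbered [pickle (l, 0)], which makes [E] a cylinder. *)
pose E := [set b : nat -> bool | b (pickle (l, 0)%N) /\ D (mask b)].
have cE : cylinder (maxn k (pickle (l, 0)%N).+1) E.
  move=> b1 b2 bb [b1l Db1]; split.
    by rewrite -bb// leq_max ltnSn orbT.
  by apply: cD Db1; apply: agree_mask; exact: agreeS (leq_maxl _ _) bb.
have mD : measurable (D : set bit_sequence) by exact: measurable_cylinder cD.
have mUD : measurable (Uinf @^-1` D) by exact: measurable_preim.
transitivity (Pinf [set x | E (b x)]); last first.
  apply: Pinf_good.
  - exact: (cylinder_measurable_preimage mb cE).
  - exact: measurableI.
  - move=> z x gz; rewrite /E /= (gz l) (Zinf_good _ _ gz).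
    by split => -[/asboolP].
rewrite (transfer_cylinder _ _ cE) integral_law//; last 2 first.
- by apply: measurable_funTS; exact/measurable_EFinP.
- by move=> t _; rewrite lee_fin; case/andP: (value01 l t).
transitivity (\int[Pinf]_(x in Uinf @^-1` D) (value l (b x))%:E).
  by apply: eq_integral => x _; rewrite /= -[in RHS]value_mask.
rewrite integral_Rintegral_indic//.
rewrite (transfer (fun b => value l b * \1_(mask @^-1` D) b)%R); last first.
  apply: bits_continuousM; first exact: value_continuous.
  exact: bits_continuous_indic cmD.
congr EFin; congr (L _); apply/funext => i.
have [mq q01 qE] := qv i l.
have mD' : measurable (ubits i @^-1` D) by exact: (cylinder_measurable_preimage (mubits i) cD).
have := qE _ mD'; rewrite integral_law//; last 2 first.
- by apply: measurable_funTS; exact/measurable_EFinP.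
- by move=> t _; rewrite lee_fin; case/andP: (q01 t).
rewrite integral_Rintegral_indic//; last 2 first.
- exact: measurableT_comp.
- by apply: measurable_preim.
move=> /(congr1 fine) /= qE'.
transitivity (\int[jP (V i)]_w (q i l (jU (V i) w) *
    \1_(jU (V i) @^-1` (ubits i @^-1` D)) w))%R.
  apply: eq_Rintegral => w _; rewrite value_beta; congr (_ * _)%R.
  rewrite !indicE; congr (nat_of_bool _)%:R.
  by apply/idP/idP => /set_mem/= Dw; apply/mem_set; rewrite /= ?mask_beta// -mask_beta.
rewrite qE'; congr fine; congr (jP (V i) _).
apply/seteqP; split => w /=; rewrite /E /= beta0 mask_beta.
  by move=> [Zw Dw]; split => //; exact/asboolP.
by move=> [/asboolP].
Qed.

(** Common to the pair and to its two components: [idx] numbers the events describing the variable,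
    and [p] is its law, the same for all [i]. Finiteness of its entropy is the summable bound
    required by [mean_esum]. *)
Let entropy_inf dE (E : discreteMeasurableType dE) (Kinf : {RV Pinf >-> E})
    (K : forall i, {RV jP (V i) >-> E}) (idx : E -> nat) (p : E -> R) :
  (forall k, Zinf @^-1` event (idx k) = Kinf @^-1` [set k]) ->
  (forall i k, Z i @^-1` event (idx k) = K i @^-1` [set k]) ->
  (forall i k, fine (jP (V i) (K i @^-1` [set k])) = p k) ->
  \esum_(k in [set: E]) (ent_term (p k))%:E < +oo ->
  fine (cond_entropy Kinf Uinf) = L (fun i => fine (cond_entropy (K i) (jU (V i)))).
Proof.
move=> KinfE KE pE pfin.
have vinf k : is_version Uinf (Kinf @^-1` [set k]) (value (idx k)).
  by rewrite -KinfE; exact: version_inf.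
have vi i k : is_version (jU (V i)) (K i @^-1` [set k]) (q i (idx k)).
  by rewrite -KE; exact: qv.
pose a i k := (\int[jP (V i)]_w ent_term (value (idx k) (beta i w)))%R.
have aE i k : \int[distribution (jP (V i)) (jU (V i))]_t
    (ent_term (q i (idx k) t))%:E = (a i k)%:E.
  have [mq q01 _] := vi i k.
  rewrite integral_law_ent//; congr EFin; apply: eq_Rintegral => w _.
  by rewrite value_beta.
have ainfE k : \int[distribution Pinf Uinf]_t (ent_term (value (idx k) t))%:E =
    (L (a ^~ k))%:E.
  rewrite integral_law_ent//.
  have cont : bits_continuous (fun b => ent_term (value (idx k) b)).
    apply: bits_continuous_ent; first by move=> t; exact: value01.
    exact: value_continuous.
  congr EFin; rewrite -[RHS](transfer _ cont).
  by apply: eq_Rintegral => x _; rewrite /= -[in RHS]value_mask.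
rewrite (cond_entropyE vinf).
have -> : (fun i => fine (cond_entropy (K i) (jU (V i)))) =
    (fun i => fine (\esum_(k in [set: E]) (a i k)%:E)).
  apply/funext => i; rewrite (cond_entropyE (vi i)); congr fine.
  by apply: eq_esum => k _; rewrite aE.
rewrite -(mean_esum meanL (a := a) (s := fun k => ent_term (p k)))//.
- by congr fine; apply: eq_esum => k _; rewrite ainfE.
- by move=> i k; apply: Rintegral_ge0 => w _; rewrite ent_term_ge0.
- move=> i k; rewrite -lee_fin -aE -(pE i).
  apply: integral_ent_term_le; last exact: vi.
  exact: measurable_fiber.
Qed.

Let Xinf_fun (x : Omega) : A := (Zinf x).1.
Let Yinf_fun (x : Omega) : B := (Zinf x).2.

Let mXinf : measurable_fun [set: Omega] Xinf_fun.
Proof. by apply: measurableT_comp => //; exact: measurable_funPT. Qed.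

Let mYinf : measurable_fun [set: Omega] Yinf_fun.
Proof. by apply: measurableT_comp => //; exact: measurable_funPT. Qed.

HB.instance Definition _ := isMeasurableFun.Build _ _ _ _ Xinf_fun mXinf.
HB.instance Definition _ := isMeasurableFun.Build _ _ _ _ Yinf_fun mYinf.

Let Xinf : {RV Pinf >-> A} := Xinf_fun.
Let Yinf : {RV Pinf >-> B} := Yinf_fun.

Let pair_inf D : pairRV Xinf Yinf @^-1` D = Zinf @^-1` D.
Proof.
have e x : pairRV Xinf Yinf x = Zinf x by exact: esym (surjective_pairing (Zinf x)).
by apply/seteqP; split => x; rewrite /preimage /mkset e.
Qed.

Let law_inf (S : set C) : measurable S ->
  distribution Pinf (pairRV Xinf Yinf) S = distribution P (pairRV X Y) S.
Proof.
by move=> _; apply: eq_distribution_points => z; rewrite pair_inf; exact: PZinf.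
Qed.

Let law_iX i x : jP (V i) (jX (V i) @^-1` [set x]) = P (X @^-1` [set x]).
Proof.
have := @jlaw _ _ _ _ _ _ _ _ _ _ (V i) (fst @^-1` [set x]) (discrete_measurable _).
by [].
Qed.

Let law_iY i y : jP (V i) (jY (V i) @^-1` [set y]) = P (Y @^-1` [set y]).
Proof.
have := @jlaw _ _ _ _ _ _ _ _ _ _ (V i) (snd @^-1` [set y]) (discrete_measurable _).
by [].
Qed.

Lemma joint_rv_mean : entropy X < +oo -> entropy Y < +oo ->
  entropy (pairRV X Y) < +oo -> exists V' : joint_rv X Y,
  [/\ fine (cond_entropy (jX V') (jU V')) =
        L (fun i => fine (cond_entropy (jX (V i)) (jU (V i)))),
      fine (cond_entropy (jY V') (jU V')) =
        L (fun i => fine (cond_entropy (jY (V i)) (jU (V i)))) &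
      fine (cond_entropy (pairRV (jX V') (jY V')) (jU V')) =
        L (fun i => fine (cond_entropy (pairRV (jX (V i)) (jY (V i))) (jU (V i))))].
Proof.
move=> HX HY HXY; exists (@JointRV _ _ _ _ _ _ _ _ X Y _ _ Pinf Xinf Yinf _ _ Uinf law_inf).
split => /=.
- apply: (entropy_inf _ _ Xinf (fun i => jX (V i)) idX) HX.
  + by move=> x; rewrite eventX.
  + by move=> i x; rewrite eventX.
  + by move=> i x; rewrite law_iX.
- apply: (entropy_inf _ _ Yinf (fun i => jY (V i)) idY) HY.
  + by move=> y; rewrite eventY.
  + by move=> i y; rewrite eventY.
  + by move=> i y; rewrite law_iY.
- apply: (entropy_inf _ _ (pairRV Xinf Yinf) Z idZ) HXY.
  + by move=> z; rewrite eventZ pair_inf.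
  + by move=> i z; rewrite eventZ.
  + by move=> i z; rewrite lawE.
Qed.

End realization.

(** * The Gray-Wyner region *)

Section mean_instances.
Context (R : realType).
Local Open Scope ring_scope.

Lemma is_mean_mixture (lam : R) : 0 <= lam <= 1 ->
  is_mean (fun f : bool -> R => lam * f true + (1 - lam) * f false).
Proof.
move=> /andP[l0 l1]; split => [a f g _ _|f _ f0|]; [by ring| |by ring].
by rewrite addr_ge0// mulr_ge0// subr_ge0.
Qed.

(** A segment is compact, so there is a cluster point; an ultrafilter contains the preimage of each
    of its neighborhoods, since containing the complement would contradict clustering. *)
Lemma ultrafilter_bounded_cvg (G : set_system nat) (f : nat -> R) :
  UltraFilter G -> family_bounded f -> cvg (f @ G).
Proof.
move=> uG [M fM].
have /(_ (f @ G) _) : compact `[- M, M] by exact: segment_compact.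
have Gf : (f @ G) `[- M, M]%classic.
  apply: (@filterS _ G _ setT); last exact: filterT.
  by move=> n _; rewrite /= in_itv/= -ler_norml fM.
move=> /(_ Gf)[p [_ clp]]; apply/cvg_ex; exists p => D Dp.
have [//|GD] := in_ultra_setVsetC (f @^-1` D) uG.
by have [x [nDx Dx]] := clp (~` D) D GD Dp; case: (nDx Dx).
Qed.

(** The errors [n.+1%:R^-1] disappear because the ultrafilter [G] refines the filter [\oo]. *)
Lemma is_mean_ultralimit : exists L : (nat -> R) -> R, is_mean L /\
  forall f c, family_bounded f -> (forall n, f n <= c + n.+1%:R^-1) -> L f <= c.
Proof.
have [G [uG GN]] := @ultraFilterLemma _ (\oo : set_system nat) _.
have cv (f : nat -> R) : family_bounded f -> cvg (f @ G).
  by move=> bf; exact: (ultrafilter_bounded_cvg uG bf).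
exists (fun f => lim (f @ G)); split; first split.
- move=> a f g /cv cf /cv cg; apply/cvg_lim => //.
  by apply: cvgD => //; apply: cvgM => //; exact: cvg_cst.
- by move=> f /cv cf f0; apply: limr_ge => //; exact: nearW.
- by apply/cvg_lim => //; exact: cvg_cst.
- move=> f c /cv cf fc; apply/ler_addgt0Pr => e e0; apply: limr_le => //.
  have : \forall n \near \oo, n.+1%:R^-1 < e := near_infty_natSinv_lt (PosNum e0).
  move=> /GN; apply: filterS => n ne; apply: (le_trans (fc n)).
  by rewrite lerD2l ltW.
Qed.

End mean_instances.

Section gray_wyner_theory.
Context (R : realType) d (W : measurableType d) (P : probability W R).
Context dA dB (A : discreteMeasurableType dA) (B : discreteMeasurableType dB).
Variables (X : {RV P >-> A}) (Y : {RV P >-> B}).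
Hypotheses (HX : entropy X < +oo) (HY : entropy Y < +oo).

Local Notation entX := (fine (entropy X)).
Local Notation entY := (fine (entropy Y)).
Local Notation entXY := (fine (entropy (pairRV X Y))).

Definition rateX (U : joint_rv X Y) : R := fine (cond_entropy (jX U) (jU U)).
Definition rateY (U : joint_rv X Y) : R := fine (cond_entropy (jY U) (jU U)).
Definition rateXY (U : joint_rv X Y) : R :=
  fine (cond_entropy (pairRV (jX U) (jY U)) (jU U)).

Lemma eq_entropy dE (E : discreteMeasurableType dE)
    d1 (W1 : measurableType d1) (P1 : probability W1 R) (Z1 : {RV P1 >-> E})
    d2 (W2 : measurableType d2) (P2 : probability W2 R) (Z2 : {RV P2 >-> E}) :
  (forall z, P1 (Z1 @^-1` [set z]) = P2 (Z2 @^-1` [set z])) ->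
  entropy Z1 = entropy Z2.
Proof.
by move=> ZE; apply: eq_esum => z _; rewrite /distribution /pushforward ZE.
Qed.

Lemma entropy_ge0 dE (E : discreteMeasurableType dE)
    d1 (W1 : measurableType d1) (P1 : probability W1 R) (Z1 : {RV P1 >-> E}) :
  0 <= entropy Z1.
Proof. by rewrite -(cond_entropy_cst Z1 true) cond_entropy_ge0. Qed.

Lemma entropy_jX (U : joint_rv X Y) : entropy (jX U) = entropy X.
Proof.
apply: eq_entropy => x.
exact: (@jlaw _ _ _ _ _ _ _ _ _ _ U (fst @^-1` [set x]) (discrete_measurable _)).
Qed.

Lemma entropy_jY (U : joint_rv X Y) : entropy (jY U) = entropy Y.
Proof.
apply: eq_entropy => y.
exact: (@jlaw _ _ _ _ _ _ _ _ _ _ U (snd @^-1` [set y]) (discrete_measurable _)).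
Qed.

Lemma entropy_jXY (U : joint_rv X Y) :
  entropy (pairRV (jX U) (jY U)) = entropy (pairRV X Y).
Proof.
apply: eq_entropy => z.
exact: (@jlaw _ _ _ _ _ _ _ _ _ _ U [set z] (discrete_measurable _)).
Qed.

Lemma HXY : entropy (pairRV X Y) < +oo.
Proof.
rewrite cond_entropy_discrete; apply: lte_add_pinfty => //.
exact: le_lt_trans (cond_entropy_le X Y) HX.
Qed.

Lemma entX_fin : entropy X = entX%:E.
Proof. by rewrite fineK// ge0_fin_numE// entropy_ge0. Qed.

Lemma entY_fin : entropy Y = entY%:E.
Proof. by rewrite fineK// ge0_fin_numE// entropy_ge0. Qed.

Lemma entXY_fin : entropy (pairRV X Y) = entXY%:E.
Proof. by rewrite fineK// ge0_fin_numE ?entropy_ge0// HXY. Qed.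

Lemma cond_entropy_finite dE (E : discreteMeasurableType dE)
    d1 (W1 : measurableType d1) (P1 : probability W1 R) (Z1 : {RV P1 >-> E})
    dT (T : measurableType dT) (U : {RV P1 >-> T}) : entropy Z1 < +oo ->
  [/\ cond_entropy Z1 U = (fine (cond_entropy Z1 U))%:E,
      (0 <= fine (cond_entropy Z1 U))%R &
      (fine (cond_entropy Z1 U) <= fine (entropy Z1))%R].
Proof.
move=> Zfin; have U0 := cond_entropy_ge0 Z1 U; have UZ := cond_entropy_le Z1 U.
have Ufin : cond_entropy Z1 U \is a fin_num by rewrite ge0_fin_numE//; exact: le_lt_trans Zfin.
rewrite fineK// fine_ge0// fine_le// ge0_fin_numE//; exact: entropy_ge0.
Qed.

Lemma rateXP U : [/\ cond_entropy (jX U) (jU U) = (rateX U)%:E,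
  (0 <= rateX U)%R & (rateX U <= entX)%R].
Proof.
have := @cond_entropy_finite _ _ _ _ _ (jX U) _ _ (jU U).
by rewrite entropy_jX => /(_ HX).
Qed.

Lemma rateYP U : [/\ cond_entropy (jY U) (jU U) = (rateY U)%:E,
  (0 <= rateY U)%R & (rateY U <= entY)%R].
Proof.
have := @cond_entropy_finite _ _ _ _ _ (jY U) _ _ (jU U).
by rewrite entropy_jY => /(_ HY).
Qed.

Lemma rateXYP U : [/\ cond_entropy (pairRV (jX U) (jY U)) (jU U) = (rateXY U)%:E,
  (0 <= rateXY U)%R & (rateXY U <= entXY)%R].
Proof.
have := @cond_entropy_finite _ _ _ _ _ (pairRV (jX U) (jY U)) _ _ (jU U).
by rewrite entropy_jXY => /(_ HXY).
Qed.

Lemma info_XYE U : info_XY U = (entXY - rateXY U)%:E.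
Proof.
by rewrite /info_XY /mutual_info entropy_jXY entXY_fin; have [-> _ _] := rateXYP U.
Qed.

Lemma EFin_addI (a c : R) (x : \bar R) : c%:E = a%:E + x -> x = (c - a)%:E.
Proof. by case: x => [x| |]// [->]; congr EFin; ring. Qed.

Lemma cond_XgivenYU U :
  cond_entropy (jX U) (pairRV (jY U) (jU U)) = (rateXY U - rateY U)%:E.
Proof.
apply: EFin_addI; have [<- _ _] := rateXYP U; have [<- _ _] := rateYP U.
exact: cond_entropy_chain.
Qed.

Lemma cond_YgivenXU U :
  cond_entropy (jY U) (pairRV (jX U) (jU U)) = (rateXY U - rateX U)%:E.
Proof.
apply: EFin_addI; have [<- _ _] := rateXYP U; have [<- _ _] := rateXP U.
by rewrite cond_entropy_pairC; exact: cond_entropy_chain.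
Qed.

Lemma cond_XgivenY : cond_entropy X Y = (entXY - entY)%:E.
Proof.
by apply: EFin_addI; rewrite -entXY_fin -entY_fin cond_entropy_discrete.
Qed.

Lemma info_X_Y_givenE U :
  info_X_Y_given U = (rateX U + rateY U - rateXY U)%:E.
Proof.
rewrite /info_X_Y_given /cond_mutual_info cond_XgivenYU; have [-> _ _] := rateXP U.
by rewrite -EFinB; congr EFin; ring.
Qed.

(** The chain rule gives I(X;U|Y) = H(X,Y) - H(Y) - H(X,Y|U) + H(Y|U), and symmetrically. The term
    H(X,Y) - H(X,Y|U) occurs twice, whence the weight 2 of R0 in the definition of K. *)
Lemma info_privateE U : info_X_given_Y U + info_Y_given_X U =
  (2 * (entXY - rateXY U) + rateX U + rateY U - entX - entY)%:E.
Proof.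
rewrite /info_X_given_Y /info_Y_given_X /cond_mutual_info.
rewrite -[cond_entropy (jX U) (pairRV _ _)]cond_entropy_condC cond_XgivenYU.
rewrite -[cond_entropy (jY U) (pairRV _ _)]cond_entropy_condC cond_YgivenXU.
have -> : cond_entropy (jX U) (jY U) = (entXY - entY)%:E.
  apply: EFin_addI; rewrite -entXY_fin -(entropy_jXY U) -entY_fin -(entropy_jY U).
  exact: cond_entropy_discrete.
have -> : cond_entropy (jY U) (jX U) = (entXY - entX)%:E.
  apply: EFin_addI; rewrite -entXY_fin -(entropy_jXY U) -entX_fin -(entropy_jX U).
  rewrite -(cond_entropy_cst _ true) cond_entropy_pairC cond_entropy_cst.
  exact: cond_entropy_discrete.
by rewrite -!EFinB -EFinD; congr EFin; ring.
Qed.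

Lemma mutual_infoE : mutual_info X Y = (entX + entY - entXY)%:E.
Proof.
rewrite /mutual_info cond_XgivenY entX_fin -EFinB; congr EFin.
by rewrite opprB addrA.
Qed.

(** With [joint_pair], the two extremes, no information and full information; they are the partners
    in the mixtures of [erasure] and [revelation]. *)
Definition joint_cst : joint_rv X Y :=
  @JointRV _ _ _ _ _ _ _ _ X Y _ _ P X Y _ _ (cst true : {RV P >-> bool})
    (fun S _ => erefl).

Definition joint_pair : joint_rv X Y :=
  @JointRV _ _ _ _ _ _ _ _ X Y _ _ P X Y _ _ (pairRV X Y) (fun S _ => erefl).

Lemma rates_cst : [/\ rateX joint_cst = entX, rateY joint_cst = entY &
  rateXY joint_cst = entXY].
Proof. by rewrite /rateX /rateY /rateXY /= !cond_entropy_cst. Qed.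

Lemma rates_pair : [/\ rateX joint_pair = 0%R, rateY joint_pair = 0%R &
  rateXY joint_pair = 0%R].
Proof.
rewrite /rateX /rateY /rateXY /=.
rewrite (@cond_entropy_fun _ _ _ _ _ _ X _ _ (pairRV X Y) fst)//.
rewrite (@cond_entropy_fun _ _ _ _ _ _ Y _ _ (pairRV X Y) snd)//.
by rewrite (@cond_entropy_fun _ _ _ _ _ _ (pairRV X Y) _ _ (pairRV X Y) id).
Qed.

Lemma mixture_exists (U0 U1 : joint_rv X Y) (lam : R) : (0 <= lam <= 1)%R ->
  exists U, [/\ rateX U = lam * rateX U1 + (1 - lam) * rateX U0,
    rateY U = lam * rateY U1 + (1 - lam) * rateY U0 &
    rateXY U = lam * rateXY U1 + (1 - lam) * rateXY U0]%R.
Proof.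
move=> lam01; have [U] := @joint_rv_mean _ _ _ _ _ _ _ _ X Y _ _
  (is_mean_mixture lam01) (fun c : bool => if c then U1 else U0) HX HY HXY.
by exists U.
Qed.

(** One [V] serves for all linear inequalities at once; using both signs of the coefficients,
    equalities pass to the limit as well. *)
Lemma limit_exists (U : nat -> joint_rv X Y) : exists V, forall a b c e : R,
  (forall n, a * rateX (U n) + b * rateY (U n) + c * rateXY (U n)
     <= e + n.+1%:R^-1)%R ->
  (a * rateX V + b * rateY V + c * rateXY V <= e)%R.
Proof.
have [L [meanL Lle]] := is_mean_ultralimit R.
have [V [VX VY VXY]] := @joint_rv_mean _ _ _ _ _ _ _ _ X Y _ _ meanL U HX HY HXY.
exists V => a b c e abc.
have bX : family_bounded (fun n => rateX (U n)).
  by exists entX => n; have [_ h0 h1] := rateXP (U n); rewrite ger0_norm.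
have bY : family_bounded (fun n => rateY (U n)).
  by exists entY => n; have [_ h0 h1] := rateYP (U n); rewrite ger0_norm.
have bXY : family_bounded (fun n => rateXY (U n)).
  by exists entXY => n; have [_ h0 h1] := rateXYP (U n); rewrite ger0_norm.
rewrite /rateX VX /rateY VY /rateXY VXY.
have bXa := family_boundedZ a bX; have bYb := family_boundedZ b bY.
have bXYc := family_boundedZ c bXY.
have bXaYb := family_boundedD bXa bYb.
rewrite -(meanZ meanL a bX) -(meanZ meanL b bY) -(meanZ meanL c bXY).
rewrite -(meanD meanL bXa bYb) -(meanD meanL bXaYb bXYc).
by apply: Lle => //; exact: family_boundedD.
Qed.

Lemma gray_wyner_tuplesP (r : R^o * R^o * R^o) : gray_wyner_tuples X Y r <->
  exists U, [/\ entXY - rateXY U <= r.1.1, rateX U <= r.1.2 & rateY U <= r.2]%R.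
Proof.
split=> -[U [h0 h1 h2]]; exists U; move: h0 h1 h2; rewrite info_XYE !lee_fin;
  by have [-> _ _] := rateXP U; have [-> _ _] := rateYP U; rewrite ?lee_fin.
Qed.

Lemma closed_gray_wyner_tuples : closed (gray_wyner_tuples X Y).
Proof.
move=> r clr.
have Un n : exists U, [/\ entXY - rateXY U <= r.1.1 + n.+1%:R^-1,
    rateX U <= r.1.2 + n.+1%:R^-1 & rateY U <= r.2 + n.+1%:R^-1]%R.
  have e0 : (0 < n.+1%:R^-1 :> R)%R by rewrite invr_gt0.
  have [r' [/gray_wyner_tuplesP[U [h0 h1 h2]] [[/= b0 b1] /= b2]]] :=
    clr _ (nbhsx_ballx r _ e0).
  exists U; move: b0 b1 b2; rewrite -!ball_normE /= => b0 b1 b2.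
  have g (x y e : R) : (`|x - y| < e)%R -> (y <= x + e)%R.
    by rewrite ltr_norml => /andP[]; lra.
  by split; [apply: le_trans h0 (g _ _ _ b0)|apply: le_trans h1 (g _ _ _ b1)|
    apply: le_trans h2 (g _ _ _ b2)].
have [V hV] := limit_exists (fun n => sval (cid (Un n))).
have le0 (p q s t x e : R) : (t - s <= x + e -> 0 * p + 0 * q + -1 * s <= x - t + e)%R.
  by lra.
have le1 (p q s x e : R) : (p <= x + e -> 1 * p + 0 * q + 0 * s <= x + e)%R by lra.
have le2 (p q s x e : R) : (q <= x + e -> 0 * p + 1 * q + 0 * s <= x + e)%R by lra.
apply/gray_wyner_tuplesP; exists V; split.
- have := hV 0%R 0%R (-1)%R (r.1.1 - entXY)%R; rewrite !mul0r !add0r mulN1r => h.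
  rewrite addrC -lerBrDr; apply: h => n.
  by have [h0 _ _] := svalP (cid (Un n)); exact: le0.
- have := hV 1%R 0%R 0%R r.1.2; rewrite !mul0r !addr0 mul1r; apply => n.
  by have [_ h0 _] := svalP (cid (Un n)); exact: le1.
- have := hV 0%R 1%R 0%R r.2; rewrite !mul0r !addr0 add0r mul1r; apply => n.
  by have [_ _ h0] := svalP (cid (Un n)); exact: le2.
Qed.

Lemma convex_gray_wyner_tuples :
  convex_set (M := (R^o * R^o * R^o)%type) (gray_wyner_tuples X Y).
Proof.
move=> r s lam /set_mem/gray_wyner_tuplesP[U [U0 U1 U2]].
move=> /set_mem/gray_wyner_tuplesP[V [V0 V1 V2]]; apply/mem_set.
have lam01 : (0 <= (lam%:num : R) <= 1)%R by rewrite ge0 le1.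
(* The weight [lam] belongs to the second argument, [U], as it does to the first tuple in the convex
   combination. *)
have [T [T1 T2 T0]] := mixture_exists V U lam01.
have /andP[l0 l1] := lam01; have l1' : (0 <= 1 - lam%:num :> R)%R by rewrite subr_ge0.
apply/gray_wyner_tuplesP; exists T; rewrite T0 T1 T2.
have := (ler_wpM2l l0 U0, ler_wpM2l l0 U1, ler_wpM2l l0 U2,
  ler_wpM2l l1' V0, ler_wpM2l l1' V1, ler_wpM2l l1' V2).
move=> [[[[[hU0 hU1] hU2] hV0] hV1] hV2].
split => /=.
- apply: le_trans (lerD hU0 hV0); lra.
- exact: lerD.
- exact: lerD.
Qed.

Lemma gray_wyner_regionE : gray_wyner_region X Y = gray_wyner_tuples X Y.
Proof.
apply/seteqP; split; last exact: sub_gen_smallest.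
apply: smallest_sub => //; split.
  exact: closed_gray_wyner_tuples.
exact: convex_gray_wyner_tuples.
Qed.

(** This is I(X;Y|U), by [info_X_Y_givenE]; [excess] is I(X;U|Y) + I(Y;U|X), by [info_privateE]. *)
Let private_gap (U : joint_rv X Y) : R := (rateX U + rateY U - rateXY U)%R.

Let excess (U : joint_rv X Y) : R :=
  (2 * (entXY - rateXY U) + rateX U + rateY U - entX - entY)%R.

Lemma interpolation (v i t : R) : (v <= t <= i)%R ->
  exists lam : R, ((0 <= lam <= 1) /\ lam * i + (1 - lam) * v = t)%R.
Proof.
move=> /andP[vt ti]; have [iv|iv] := eqVneq i v.
  by exists 0%R; split; [rewrite lexx ler01|lra].
have iv0 : (0 < i - v)%R by rewrite subr_gt0 lt_neqAle eq_sym iv (le_trans vt).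
exists ((t - v) / (i - v))%R; split; last by field; rewrite gt_eqF.
rewrite divr_ge0 ?(ltW iv0) ?subr_ge0//= ler_pdivrMr// mul1r; lra.
Qed.

(* Erasing [U] at random raises [I(X;Y|U)] up to [I(X;Y)] and only lowers
   [I(X,Y;U)]. *)
Lemma erasure (U : joint_rv X Y) (t : R) :
  (private_gap U <= t <= entX + entY - entXY)%R ->
  exists V, private_gap V = t /\ (rateXY U <= rateXY V)%R.
Proof.
move=> /interpolation[lam [lam01 lamE]].
have [V [VX VY VXY]] := mixture_exists U joint_cst lam01.
have [cX cY cXY] := rates_cst; rewrite cX cY cXY in VX VY VXY.
exists V; rewrite /private_gap VX VY VXY; split.
  by rewrite -lamE /private_gap; ring.
have [_ _ h] := rateXYP U; move/andP: lam01 => [l0 l1].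
by have := ler_wpM2l l0 h; lra.
Qed.

(* Revealing [(X, Y)] at random raises [I(X;U|Y) + I(Y;U|X)] up to
   [H(X,Y) - I(X;Y)] and only lowers [H(X|U) + H(Y|U)]. *)
Lemma revelation (U : joint_rv X Y) (t : R) :
  (excess U <= t <= 2 * entXY - entX - entY)%R ->
  exists V, excess V = t /\ (rateX V + rateY V <= rateX U + rateY U)%R.
Proof.
move=> /interpolation[lam [lam01 lamE]].
have [V [VX VY VXY]] := mixture_exists U joint_pair lam01.
have [cX cY cXY] := rates_pair; rewrite cX cY cXY in VX VY VXY.
exists V; rewrite /excess VX VY VXY; split.
  by rewrite -lamE /excess; ring.
have [_ h _] := rateXP U; have [_ h' _] := rateYP U; move/andP: lam01 => [l0 l1].
by have := mulr_ge0 l0 h; have := mulr_ge0 l0 h'; lra.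
Qed.

Lemma gray_wyner_regionP (r : R^o * R^o * R^o) : gray_wyner_region X Y r <->
  exists U, [/\ entXY - rateXY U <= r.1.1, rateX U <= r.1.2 & rateY U <= r.2]%R.
Proof. by rewrite gray_wyner_regionE gray_wyner_tuplesP. Qed.

Lemma relaxed_wyner_ci_le (t : R) (U : joint_rv X Y) : private_gap U = t ->
  relaxed_wyner_ci X Y t <= (entXY - rateXY U)%:E.
Proof.
move=> Ut; apply: ereal_inf_lbound.
exists ((entXY - rateXY U, rateX U, rateY U)%R : R^o * R^o * R^o) => //=; split.
  by apply/gray_wyner_regionP; exists U; split => /=.
by rewrite entXY_fin -EFinD; congr EFin; rewrite -Ut /private_gap; ring.
Qed.

(** A tuple in the plane of the constraint only yields [private_gap U <= t]. This inequality passes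
    to the limit, and [erasure] then restores equality without raising I(X,Y;U). *)
Lemma relaxed_wyner_ci_attained (t : R) : (0 <= t <= entX + entY - entXY)%R ->
  exists V, private_gap V = t /\ relaxed_wyner_ci X Y t = (entXY - rateXY V)%:E.
Proof.
move=> /andP[t0 tI].
(* The gap of (X, Y) itself is 0, so [erasure] reaches any [t] up to I(X;Y) and the infimum is not
   over the empty set. *)
have [U0 [U0t _]] : exists V, private_gap V = t /\ (rateXY joint_pair <= rateXY V)%R.
  apply: erasure; have [pX pY pXY] := rates_pair.
  by rewrite /private_gap pX pY pXY tI andbT; lra.
set rho := relaxed_wyner_ci X Y t.
have feasible (r : R^o * R^o * R^o) : gray_wyner_region X Y r ->
    (r.1.1 + r.1.2 + r.2)%:E = entropy (pairRV X Y) + t%:E ->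
    exists U, (entXY - rateXY U <= (r.1.1 : R))%R /\ (private_gap U <= t)%R.
  move=> /gray_wyner_regionP[U [h0 h1 h2]]; rewrite entXY_fin -EFinD => -[h].
  by exists U; split => //; rewrite /private_gap; lra.
have rho_fin : rho \is a fin_num.
  rewrite ge0_fin_numE.
    exact: le_lt_trans (relaxed_wyner_ci_le U0t) (ltry _).
  apply: le_ereal_inf_tmp => _ [r [rr rt] <-].
  have [U [h _]] := feasible r rr rt; rewrite lee_fin; apply: le_trans h.
  by rewrite subr_ge0; case: (rateXYP U).
have Un n : exists U, (entXY - rateXY U <= fine rho + n.+1%:R^-1)%R /\
    (private_gap U <= t)%R.
  have e0 : (0 < n.+1%:R^-1 :> R)%R by rewrite invr_gt0.
  have [_ [r [rr rt] <-] rlt] := lb_ereal_inf_adherent e0 rho_fin.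
  have [U [h Ut]] := feasible r rr rt; exists U; split => //.
  apply: (le_trans h); rewrite -lee_fin EFinD fineK//; exact: ltW.
have [V hV] := limit_exists (fun n => sval (cid (Un n))).
have nV (n : nat) : (0 <= n.+1%:R^-1 :> R)%R by rewrite invr_ge0.
have hgap : (private_gap V <= t)%R.
  have := hV 1%R 1%R (-1)%R t; rewrite !mul1r mulN1r; apply => n.
  have key (x y z e : R) : (0 <= e -> x + y - z <= t ->
    1 * x + 1 * y + -1 * z <= t + e)%R by lra.
  by apply: key => //; case: (svalP (cid (Un n))).
have hinfo : (entXY - rateXY V <= fine rho)%R.
  have := hV 0%R 0%R (-1)%R (fine rho - entXY)%R.
  rewrite !mul0r !add0r mulN1r => h.
  rewrite addrC -lerBrDr; apply: h => n.
  have key (x y z e : R) : (entXY - z <= fine rho + e ->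
    0 * x + 0 * y + -1 * z <= fine rho - entXY + e)%R by lra.
  by apply: key; case: (svalP (cid (Un n))).
have [V' [V't VV']] : exists V', private_gap V' = t /\ (rateXY V <= rateXY V')%R.
  by apply: erasure; rewrite hgap.
exists V'; split => //; apply/eqP; rewrite eq_le relaxed_wyner_ci_le//=.
by rewrite -/rho -(fineK rho_fin) lee_fin; lra.
Qed.

Lemma relaxed_gacs_korner_ci_ge (t : R) (U : joint_rv X Y) : excess U = t ->
  (entXY - rateXY U)%:E <= relaxed_gacs_korner_ci X Y t.
Proof.
move=> Ut; apply: ereal_sup_ubound.
exists ((entXY - rateXY U, rateX U, rateY U)%R : R^o * R^o * R^o) => //=; split.
  by apply/gray_wyner_regionP; exists U; split => /=.
rewrite entX_fin entY_fin -!EFinD; congr EFin.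
by rewrite -Ut /excess; ring.
Qed.

(** In a tuple, R0 bounds I(X,Y;U) from above, the wrong side for a supremum. Hence equality in the
    constraint is restored before the limit, by [revelation], and passes to it as two
    inequalities. *)
Lemma relaxed_gacs_korner_ci_attained (t : R) :
  (0 <= t <= 2 * entXY - entX - entY)%R ->
  exists V, excess V = t /\ relaxed_gacs_korner_ci X Y t = (entXY - rateXY V)%:E.
Proof.
move=> /andP[t0 tI].
have [U0 [U0t _]] : exists V, excess V = t /\
    (rateX V + rateY V <= rateX joint_cst + rateY joint_cst)%R.
  apply: revelation; have [pX pY pXY] := rates_cst.
  by rewrite /excess pX pY pXY tI andbT; lra.
set rho := relaxed_gacs_korner_ci X Y t.
have feasible (r : R^o * R^o * R^o) : gray_wyner_region X Y r ->
    (2 * r.1.1 + r.1.2 + r.2)%:E = entropy X + entropy Y + t%:E ->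
    exists U, ((r.1.1 : R) <= entXY - rateXY U)%R /\ excess U = t.
  move=> /gray_wyner_regionP[U [h0 h1 h2]]; rewrite entX_fin entY_fin -!EFinD => -[h].
  (* With [excess V = t], 2 I(X,Y;V) = H(X) + H(Y) + t - H(X|V) - H(Y|V). This is at least 2 R0,
     because H(X|V) + H(Y|V) is at most R1 + R2. *)
  have [V [Vt VU]] : exists V, excess V = t /\ (rateX V + rateY V <= rateX U + rateY U)%R.
    by apply: revelation; rewrite tI andbT /excess; lra.
  by exists V; split => //; move: Vt; rewrite /excess; lra.
have rho_fin : rho \is a fin_num.
  rewrite fin_numElt; apply/andP; split.
    exact: lt_le_trans (ltNyr _) (relaxed_gacs_korner_ci_ge U0t).
  apply: (@le_lt_trans _ _ entXY%:E); last exact: ltry.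
  apply: ge_ereal_sup => _ [r [rr rt] <-].
  have [U [h _]] := feasible r rr rt; rewrite lee_fin; apply: (le_trans h).
  by rewrite gerBl; case: (rateXYP U).
have Un n : exists U, (fine rho - n.+1%:R^-1 <= entXY - rateXY U)%R /\ excess U = t.
  have e0 : (0 < n.+1%:R^-1 :> R)%R by rewrite invr_gt0.
  have [_ [r [rr rt] <-] rlt] := ub_ereal_sup_adherent e0 rho_fin.
  have [U [h Ut]] := feasible r rr rt; exists U; split => //.
  apply: le_trans h; rewrite -lee_fin EFinB fineK//; exact: ltW.
have [V hV] := limit_exists (fun n => sval (cid (Un n))).
have nV (n : nat) : (0 <= n.+1%:R^-1 :> R)%R by rewrite invr_ge0.
have hle : (excess V <= t)%R.
  have := hV 1%R 1%R (-2)%R (t + entX + entY - 2 * entXY)%R => h.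
  suff : (1 * rateX V + 1 * rateY V + -2 * rateXY V <=
    t + entX + entY - 2 * entXY)%R by rewrite /excess; lra.
  apply: h => n.
  have key (x y z e : R) : (0 <= e ->
    2 * (entXY - z) + x + y - entX - entY = t ->
    1 * x + 1 * y + -2 * z <= t + entX + entY - 2 * entXY + e)%R by lra.
  by apply: key => //; case: (svalP (cid (Un n))).
have hge : (t <= excess V)%R.
  have := hV (-1)%R (-1)%R 2%R (2 * entXY - t - entX - entY)%R => h.
  suff : (-1 * rateX V + -1 * rateY V + 2 * rateXY V <=
    2 * entXY - t - entX - entY)%R by rewrite /excess; lra.
  apply: h => n.
  have key (x y z e : R) : (0 <= e ->
    2 * (entXY - z) + x + y - entX - entY = t ->
    -1 * x + -1 * y + 2 * z <= 2 * entXY - t - entX - entY + e)%R by lra.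
  by apply: key => //; case: (svalP (cid (Un n))).
have hinfo : (fine rho <= entXY - rateXY V)%R.
  have := hV 0%R 0%R 1%R (entXY - fine rho)%R => h.
  suff : (0 * rateX V + 0 * rateY V + 1 * rateXY V <= entXY - fine rho)%R by lra.
  apply: h => n.
  have key (x y z e : R) : (fine rho - e <= entXY - z ->
    0 * x + 0 * y + 1 * z <= entXY - fine rho + e)%R by lra.
  by apply: key; case: (svalP (cid (Un n))).
have Vt : excess V = t by apply/eqP; rewrite eq_le hle.
exists V; split => //; apply/eqP; rewrite eq_le relaxed_gacs_korner_ci_ge// andbT.
by rewrite -/rho -(fineK rho_fin) lee_fin.
Qed.

End gray_wyner_theory.

Theorem theorem4 (R : realType) (d : measure_display) (W : measurableType d)
    (P : probability W R) (dA dB : measure_display)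
    (A : discreteMeasurableType dA) (B : discreteMeasurableType dB)
    (X : {RV P >-> A}) (Y : {RV P >-> B})
    (HX : entropy X < +oo) (HY : entropy Y < +oo) :
  (forall R' : R, (0 <= R')%R -> R'%:E <= mutual_info X Y ->
     (exists U : joint_rv X Y,
        info_X_Y_given U = R'%:E /\ relaxed_wyner_ci X Y R' = info_XY U) /\
     (forall U : joint_rv X Y,
        info_X_Y_given U = R'%:E -> relaxed_wyner_ci X Y R' <= info_XY U)) /\
  (forall R'' : R, (0 <= R'')%R ->
     R''%:E <= entropy (pairRV X Y) - mutual_info X Y ->
     (exists V : joint_rv X Y,
        info_X_given_Y V + info_Y_given_X V = R''%:E /\
        relaxed_gacs_korner_ci X Y R'' = info_XY V) /\
     (forall V : joint_rv X Y,
        info_X_given_Y V + info_Y_given_X V = R''%:E ->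
        info_XY V <= relaxed_gacs_korner_ci X Y R'')).
Proof.
have PC := info_X_Y_givenE HX HY; have KP := info_privateE HX HY.
rewrite (mutual_infoE HX HY) (entXY_fin HX HY); split.
- move=> t t0; rewrite lee_fin => tI; split.
    have [|V [Vt VE]] := @relaxed_wyner_ci_attained _ _ _ _ _ _ _ _ X Y HX HY t.
      by rewrite t0.
    by exists V; rewrite PC (info_XYE HX HY) Vt.
  by move=> U; rewrite PC (info_XYE HX HY) => -[/relaxed_wyner_ci_le]; exact.
- move=> t t0; rewrite -EFinB lee_fin => tI; split.
    have [|V [Vt VE]] := @relaxed_gacs_korner_ci_attained _ _ _ _ _ _ _ _ X Y HX HY t.
      (* H(X,Y) - I(X;Y) equals 2 H(X,Y) - H(X) - H(Y), the excess of [joint_pair]. *)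
      by rewrite t0 /=; lra.
    by exists V; rewrite KP (info_XYE HX HY) Vt.
  by move=> U; rewrite KP (info_XYE HX HY) => -[/relaxed_gacs_korner_ci_ge]; exact.
Qed.
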